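(* Let $(\mathcal H_t)_{t>0}$ be the Ornstein--Uhlenbeck semigroup on $\mathbb R^n$ determined by $Q$ and $B$, with invariant measure $\gamma_\infty$. Let $1\le\varrho<2$ and $1\le p<\infty$. Then the uniform $\varrho$-oscillation estimate in $L^p(\gamma_\infty)$ fails for $(\mathcal H_t)$; that is, there is no constant $C<\infty$ such that $\|\mathcal O^\varrho_{\{t_i\},N}(\mathcal H_t f:t\in\mathbb R_+)\|_{L^p(\gamma_\infty)}\le C\|f\|_{L^p(\gamma_\infty)}$ for all $f\in L^p(\gamma_\infty)$, all $N\ge1$ and all monotone sequences $(t_i)_0^N$ in $\mathbb R_+$. More specifically, for each large integer $N$ there are a function $f_N\in L^p(\gamma_\infty)$ and a decreasing sequence $(t_i)_0^N$ (depending on $N$) in $(0,1]$ such that $$\frac{\|\mathcal O^\varrho_{\{t_i\},N}(\mathcal H_t f_N:\ t\in(0,1])\|_{L^p(\gamma_\infty)}}{\|f_N\|_{L^p(\gamma_\infty)}}\to\infty\qquad\text{as }N\to\infty.$$ The weak type $(1,1)$ inequality for the $\varrho$-oscillation also fails; that is, there is no constant $C<\infty$ such that $\|\mathcal O^\varrho_{\{t_i\},N}(\mathcal H_t f:t\in\mathbb R_+)\|_{L^{1,\infty}(\gamma_\infty)}\le C\|f\|_{L^1(\gamma_\infty)}$ for all $f\in L^1(\gamma_\infty)$, all $N\ge 1$ and all monotone sequences $(t_i)_0^N$ in $\mathbb R_+$.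
   Context: Fix $n\ge 1$, a real symmetric positive definite $n\times n$ matrix $Q$, and a real $n\times n$ matrix $B$ all of whose eigenvalues have negative real parts. For $t\in(0,+\infty]$ let $Q_t=\int_0^t e^{sB}Qe^{sB^*}\,ds$ and let $\gamma_t$ be the Gaussian probability measure $d\gamma_t(x)=(2\pi)^{-n/2}(\det Q_t)^{-1/2}e^{-\frac12\langle Q_t^{-1}x,x\rangle}\,dx$. The Ornstein--Uhlenbeck semigroup is $\mathcal H_t f(x)=\int_{\mathbb R^n} f(e^{tB}x-y)\,d\gamma_t(y)$ for $t>0$, $x\in\mathbb R^n$, $f\in L^1(\gamma_\infty)$; $\gamma_\infty$ is its invariant measure. $\mathbb R_+=(0,\infty)$. For an interval $\mathcal I\subset\mathbb R_+$, a finite (strictly) monotone sequence $(t_i)_0^N$ in $\mathcal I$ and $1\le\varrho<\infty$, the oscillation of order $\varrho$ at $x$ is $$\mathcal O^\varrho_{\{t_i\},N}(\mathcal H_t f(x):t\in\mathcal I)=\Big(\sum_{i=1}^N\ \sup_{t}|\mathcal H_t f(x)-\mathcal H_{t_i}f(x)|^\varrho\Big)^{1/\varrho},$$ where in the $i$-th term the supremum is over all $t$ in the closed interval with endpoints $t_{i-1}$ and $t_i$. The weak $L^1$ quasi-norm is $\|g\|_{L^{1,\infty}(\gamma_\infty)}=\sup_{\alpha>0}\alpha\,\gamma_\infty\{x:|g(x)|>\alpha\}$. *)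

(* Defs.v *)
From HB Require Import structures.
From mathcomp Require Import all_boot all_order all_algebra complex.
From mathcomp Require Import all_classical all_reals all_analysis.
From mathcomp Require Import measurable_realfun.
Import Order.TTheory GRing.Theory Num.Theory.
Import numFieldNormedType.Exports.

Set Implicit Arguments.
Unset Strict Implicit.
Unset Printing Implicit Defensive.

Local Open Scope classical_set_scope.
Local Open Scope ring_scope.

(* R^n is 'cV[R]_n with the sigma-algebra generated by the coordinates, which
   is the Borel sigma-algebra. *)
Section measurable_colvec.
Variables (R : realType) (n : nat).

Let coord (i : 'I_n) (x : 'cV[R]_n) : R := x i 0.

Let colvec_set0 : g_sigma_preimage coord set0.
Proof. exact: sigma_algebra0. Qed.

Let colvec_setC A : g_sigma_preimage coord A -> g_sigma_preimage coord (~` A).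
Proof. exact: sigma_algebraC. Qed.

Let colvec_bigcup (F : _^nat) : (forall i, g_sigma_preimage coord (F i)) ->
  g_sigma_preimage coord (\bigcup_i (F i)).
Proof. exact: sigma_algebra_bigcup. Qed.

HB.instance Definition _ := @isMeasurable.Build
  (measure_tuple_display default_measure_display) 'cV[R]_n
  (g_sigma_preimage coord) colvec_set0 colvec_setC colvec_bigcup.

Lemma measurable_coord (i : 'I_n) :
  measurable_fun setT (fun x : 'cV[R]_n => x i 0).
Proof.
move=> _ Y mY; rewrite setTI; apply: sub_sigma_algebra => /=.
rewrite -bigcup_seq/=; exists i => /=; first by rewrite mem_index_enum.
by exists Y => //; rewrite setTI.
Qed.

Lemma measurable_fun_colvec d (T : measurableType d) (f : T -> 'cV[R]_n) :
  (forall i, measurable_fun setT (fun t => f t i 0)) -> measurable_fun setT f.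
Proof.
move=> mf _ A mA; rewrite setTI.
suff : (g_sigma_preimage coord `<=` [set B | measurable (f @^-1` B)])
  by exact.
apply: smallest_sub.
- split => /=.
  + by rewrite preimage_set0.
  + by move=> B mB; rewrite setTD preimage_setC; exact: measurableC.
  + by move=> F mF; rewrite preimage_bigcup; exact: bigcupT_measurable.
- rewrite -bigcup_seq => B [i _ [C mC <-]] /=.
  by rewrite setTI -[X in measurable X]setTI; exact: (mf i).
Qed.

End measurable_colvec.

Definition vcons (R : realType) (n : nat)
    (z : measurableTypeR R * 'cV[R]_n) : 'cV[R]_(n.+1) :=
  \col_i (if unlift 0 i is Some j then z.2 j 0 else z.1).

Lemma measurable_vcons (R : realType) (n : nat) :
  measurable_fun setT (@vcons R n).
Proof.
apply: measurable_fun_colvec => i; rewrite /vcons.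
case: (unliftP 0 i) => [j|] ->.
- rewrite (_ : (fun _ => _) = (fun x : 'cV[R]_n => x j 0) \o snd); last first.
    by apply/funext => z /=; rewrite mxE liftK.
  by apply: measurableT_comp; [exact: measurable_coord|exact: measurable_snd].
- rewrite (_ : (fun _ => _) = fst); first exact: measurable_fst.
  by apply/funext => z; rewrite mxE unlift_none.
Qed.

Section lebesgue_step.
Local Open Scope ereal_scope.
Variables (R : realType) (n : nat).
Variable nu : {sigma_finite_measure set 'cV[R]_n -> \bar R}.

Definition lebesgue_step : set 'cV[R]_(n.+1) -> \bar R :=
  pushforward (@lebesgue_measure R \x nu) (@vcons R n).

Let step0 : lebesgue_step set0 = 0.
Proof. by rewrite /lebesgue_step /pushforward preimage_set0 measure0. Qed.

Let step_ge0 A : 0 <= lebesgue_step A.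
Proof. by rewrite /lebesgue_step /pushforward; exact: measure_ge0. Qed.

Let step_sigma_additive : semi_sigma_additive lebesgue_step.
Proof.
move=> F mF tF mUF; rewrite /lebesgue_step /pushforward preimage_bigcup.
apply: measure_semi_sigma_additive.
- by move=> k; rewrite -[X in measurable X]setTI; exact: measurable_vcons.
- apply/trivIsetP => /= i j _ _ ij; rewrite -preimage_setI.
  by move/trivIsetP : tF => /(_ _ _ _ _ ij) ->//; rewrite preimage_set0.
- rewrite -preimage_bigcup -[X in measurable X]setTI.
  exact: measurable_vcons.
Qed.

HB.instance Definition _ := isMeasure.Build _ _ _ lebesgue_step
  step0 step_ge0 step_sigma_additive.

Let uncons (x : 'cV[R]_(n.+1)) : measurableTypeR R * 'cV[R]_n :=
  (x ord0 ord0, \col_i x (lift ord0 i) ord0).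

Let unconsK : cancel (@vcons R n) uncons.
Proof.
move=> [a v]; congr pair; first by rewrite mxE unlift_none.
by apply/colP => i; rewrite !mxE liftK.
Qed.

Let measurable_uncons : measurable_fun setT uncons.
Proof.
apply/measurable_fun_pairP; split.
  exact: measurable_coord.
apply: measurable_fun_colvec => i.
rewrite (_ : (fun _ => _) = fun x : 'cV[R]_n.+1 => x (lift ord0 i) ord0).
  exact: measurable_coord.
by apply/funext => x; rewrite /= mxE.
Qed.

Let step_sigma_finite : sigma_finite setT lebesgue_step.
Proof.
have [F TF Foo] : sigma_finite setT (@lebesgue_measure R \x nu).
  have /sigma_finiteP[F [TF ndF Foo]] := sigma_finiteT (@lebesgue_measure R).
  have /sigma_finiteP[G [TG ndG Goo]] := sigma_finiteT nu.
  exists (fun k => F k `*` G k).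
    rewrite -setXTT TF TG predeqE => -[x y]; split.
      move=> [/= [k _ Fkx] [l _ Gly]]; exists (maxn k l) => //; split.
      - by move: x Fkx; exact/subsetPset/ndF/leq_maxl.
      - by move: y Gly; exact/subsetPset/ndG/leq_maxr.
    by move=> [k _ []/= ? ?]; split; exists k.
  move=> k; have [? ?] := Foo k; have [? ?] := Goo k.
  split; first exact: measurableX.
  by rewrite product_measure1E// lte_mul_pinfty// ge0_fin_numE.
exists (fun k => uncons @^-1` F k); first by rewrite -preimage_bigcup -TF.
move=> k; have [mFk Fkoo] := Foo k; split.
  by rewrite -[X in measurable X]setTI; exact: measurable_uncons.
rewrite /lebesgue_step /pushforward -comp_preimage.
rewrite (_ : _ \o _ = id) ?preimage_id//.
by apply/funext => z /=; rewrite unconsK.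
Qed.

HB.instance Definition _ := Measure_isSigmaFinite.Build _ _ _ lebesgue_step
  step_sigma_finite.

End lebesgue_step.

(* Lebesgue measure on R^n, as an iterated product; R^0 carries the unit mass
   at its only point. *)
Fixpoint lebesgue_vec (R : realType) (n : nat) :
    {sigma_finite_measure set 'cV[R]_n -> \bar R} :=
  match n with
  | 0 => \d_(0 : 'cV[R]_0)
  | m.+1 => lebesgue_step (lebesgue_vec R m)
  end.

Section ornstein_uhlenbeck.
Variables (R : realType) (n : nat).
Implicit Types (A B Q S : 'M[R]_n) (f : 'cV[R]_n -> R).

Definition posdefmx S : Prop :=
  S^T = S /\ forall x : 'cV[R]_n, x != 0 -> 0 < (x^T *m S *m x) 0 0.

Definition hurwitzmx B : Prop :=
  forall z : R[i], eigenvalue (map_mx (real_complex R) B) z -> complex.Re z < 0.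

Definition expmx A : 'M[R]_n :=
  limn (series (fun k => (k`!%:R)^-1 *: A ^+ k)).

(* Q_t, for 0 < t <= +oo; the integral is taken entrywise. *)
Definition covmx Q B (t : \bar R) : 'M[R]_n :=
  \matrix_(i, j)
    \int[lebesgue_measure]_(s in [set s : R | (0 <= s%:E <= t)%E])
    (expmx (s *: B) *m Q *m expmx (s *: B^T)) i j.

Definition gauss_pdf S (x : 'cV[R]_n) : R :=
  (2 * pi) `^ (- (n%:R / 2)) * (\det S) `^ (- 2^-1) *
  expR (- 2^-1 * (x^T *m invmx S *m x) 0 0).

Definition gauss S : set 'cV[R]_n -> \bar R :=
  fun V => (\int[lebesgue_vec R n]_(x in V) (gauss_pdf S x)%:E)%E.

Lemma gauss_pdf_ge0 S x : 0 <= gauss_pdf S x.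
Proof. by rewrite !mulr_ge0 ?powR_ge0 ?expR_ge0. Qed.

Lemma measurable_gauss_pdf S : measurable_fun setT (gauss_pdf S).
Proof.
apply: measurable_funM => //; apply: measurableT_comp => //.
apply: measurable_funM => //.
rewrite (_ : (fun _ => _) = fun x : 'cV[R]_n =>
  \sum_(j < n) (\sum_(i < n) x i 0 * invmx S i j) * x j 0); last first.
  apply/funext => x; rewrite mxE; apply: eq_bigr => j _; rewrite mxE.
  by under eq_bigr do rewrite mxE.
apply: measurable_sum => j; apply: measurable_funM; last exact: measurable_coord.
apply: measurable_sum => i; apply: measurable_funM => //.
exact: measurable_coord.
Qed.

Let gauss0 S : gauss S set0 = 0%E.
Proof. by rewrite /gauss integral_set0. Qed.

Let gauss_ge0 S V : (0 <= gauss S V)%E.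
Proof. by apply: integral_ge0 => x _; rewrite lee_fin gauss_pdf_ge0. Qed.

Let gauss_sigma_additive S : semi_sigma_additive (gauss S).
Proof.
move=> F mF tF mUF; rewrite /gauss ge0_integral_bigcup//=.
- apply: is_cvg_ereal_nneg_natsum_cond => k _ _.
  by apply: integral_ge0 => x _; rewrite lee_fin gauss_pdf_ge0.
- by apply/measurable_funTS/measurable_EFinP; exact: measurable_gauss_pdf.
- by move=> x _; rewrite lee_fin gauss_pdf_ge0.
Qed.

HB.instance Definition _ S := isMeasure.Build _ _ _ (gauss S)
  (gauss0 S) (@gauss_ge0 S) (@gauss_sigma_additive S).

Definition gauss_infty Q B : {measure set 'cV[R]_n -> \bar R} :=
  gauss (covmx Q B +oo%E).

(* The Ornstein-Uhlenbeck semigroup, for t > 0. *)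
Definition OU Q B (t : R) f (x : 'cV[R]_n) : R :=
  \int[gauss (covmx Q B t%:E)]_y f (expmx (t *: B) *m x - y).

End ornstein_uhlenbeck.

Section oscillation.
Variable R : realType.
Local Open Scope ereal_scope.

(* A finite sequence (t_i)_0^N is a function on nat of which only the values
   at 0, ..., N matter. *)
Definition strict_incr N (t : nat -> R) : Prop :=
  forall i j, (i < j <= N)%N -> (t i < t j)%R.

Definition strict_decr N (t : nat -> R) : Prop :=
  forall i j, (i < j <= N)%N -> (t j < t i)%R.

Definition seq_in (I : set R) N (t : nat -> R) : Prop :=
  forall i, (i <= N)%N -> I (t i).

(* The interval in the usual notation only constrains the t_i, by seq_in: the
   suprema run over the closed intervals with endpoints t_(i-1) and t_i. *)
Definition oscillation (rho : R) N (t : nat -> R) (u : R -> R) : \bar R :=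
  (\sum_(1 <= i < N.+1)
     ereal_sup [set ((`|u s - u (t i)| `^ rho)%R)%:E | s in
       [set s : R | (Num.min (t i.-1) (t i) <= s <= Num.max (t i.-1) (t i))%R]])
  `^ rho^-1.

Definition OU_oscillation n (Q B : 'M[R]_n) (rho : R) N (t : nat -> R)
    (f : 'cV[R]_n -> R) (x : 'cV[R]_n) : \bar R :=
  oscillation rho N t (fun s => OU Q B s f x).

Definition weak_norm d (T : measurableType d) (mu : {measure set T -> \bar R})
    (g : T -> \bar R) : \bar R :=
  ereal_sup [set a%:E * mu [set x | a%:E < `|g x|] |
    a in [set a : R | (0 < a)%R]].

End oscillation.

(* Main.v *)
Require Import Defs.
From mathcomp Require Import all_boot all_order all_algebra complex.
From mathcomp Require Import all_classical all_reals all_analysis.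
From mathcomp Require Import measurable_realfun spectral ring lra.
Import Order.TTheory GRing.Theory Num.Theory.
Import numFieldNormedType.Exports.

(** Test functions are the lacunary sums [f] of [cos (w_k x_m)], [k < N], where
    [x_m] is the last coordinate.  The image of [cos (w x_m)] under [H_t] is
    [exp (- w^2 (Q_t)_mm / 2) cos (w (e^(tB) x)_m)].  Choosing the times [t_i]
    and the frequencies [w_i] alternately, with [t_i] small depending on the
    [w_k], [k < i], and [w_i] large depending on the [t_j], [j <= i], makes
    [H_(t_i) f] uniformly close to the [i]-th partial sum of [f] on a cube of
    measure at least [7/8].  Hence the [i]-th term of the oscillation is at
    least [(|cos (w_(i-1) x_m)| - 1/4)^rho], and the oscillation exceeds a
    multiple of [N^(1/rho)] on a set of measure at least [1/8].  On the other
    hand [exp (l f)] is dominated by a Riesz product, whose integral stays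
    bounded for [l = +- N^(-1/2)] when the [w_i] are lacunary enough, so that
    the [L^p] norm of [f] is at most a multiple of [N^(1/2)], for every [p]. *)

Set Implicit Arguments.
Unset Strict Implicit.
Unset Printing Implicit Defensive.

Local Open Scope classical_set_scope.
Local Open Scope ring_scope.

(** * Gaussian measures: Schur complements and marginals *)

(** The oscillation grows like N^(1/rho) and the norms at most like N^(1/2), and [rho < 2] separates
    the two rates. Riesz products replace moment computations because exponential moments control
    all L^p norms at once, so that one family also settles the weak type inequality. The cube is
    forced by the drift: e^(tB) x is close to x, for small t, only uniformly on bounded sets. The
    loss 1/4 in each increment is twice an approximation error 1/8, of which 1/16 comes from the
    frequencies already chosen and 1/16 from those chosen later. The last coordinate is used because
    Lebesgue measure on R^n is built by adding a first coordinate: Tonelli removes coordinates from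
    the front until only the last, normally distributed one remains. Of the covariances three things
    are needed: Q_t is positive definite, so that high frequencies die; (Q_t)_mm = O(t), so that low
    frequencies survive; and Q_oo is a convergent integral. The last point requires exponential
    decay of e^(sB), deduced from the spectrum of B by triangularization and a Lyapunov function. *)

Section posdef.
Variable R : realType.

Lemma posdefmx_unit n (S : 'M[R]_n) : posdefmx S -> S \in unitmx.
Proof.
move=> [Ssym Spos]; rewrite -row_free_unit -kermx_eq0;
    apply/eqP/row_matrixP => i.
rewrite row0; apply/eqP/negPn/negP => v0.
have : (row i (kermx S))^T != 0 by rewrite -trmx0 (inj_eq trmx_inj).
move=> /Spos; rewrite trmxK.
have -> : row i (kermx S) *m S = 0 by rewrite -row_mul mulmx_ker row0.
by rewrite mul0mx mxE ltxx.
Qed.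

Lemma posdefmx_inv n (S : 'M[R]_n) : posdefmx S -> posdefmx (invmx S).
Proof.
move=> PS; have uS := posdefmx_unit PS; case: PS => Ssym Spos; split.
  by rewrite trmx_inv Ssym.
move=> x x0; have := Spos (invmx S *m x).
rewrite trmx_mul trmx_inv Ssym !mulmxA mulmxKV// => -> //.
by apply: contra_neq x0 => /(congr1 (mulmx S)); rewrite mulKVmx// mulmx0.
Qed.

Lemma posdefmx_drsub n (S : 'M[R]_(1 + n)) : posdefmx S -> posdefmx (drsubmx S).
Proof.
move=> [Ssym Spos]; split; first by rewrite trmx_drsub Ssym.
move=> x x0; have := Spos (col_mx 0 x).
rewrite -[S in _ *m S *m _]submxK tr_col_mx trmx0 mul_row_block !mul0mx !add0r.
rewrite mul_row_col mulmx0 add0r; apply.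
apply: contra_neq x0 => /(congr1 dsubmx); rewrite col_mxKd => ->.
by apply/colP => i; rewrite !mxE.
Qed.

Lemma posdefmx_diag_gt0 n (S : 'M[R]_n) i : posdefmx S -> 0 < S i i.
Proof.
move=> [_ /(_ (delta_mx i 0))].
have d0 : delta_mx i 0 != 0 :> 'cV[R]_n.
  by apply/eqP => /matrixP/(_ i 0)/eqP; rewrite !mxE !eqxx oner_eq0.
by rewrite trmx_delta -rowE -colE !mxE; apply.
Qed.

Section schur_complement.
Variables (n : nat) (S : 'M[R]_(1 + n)).
Hypothesis PS : posdefmx S.
Let P : 'M[R]_(1 + n) := invmx S.
Let a := P ord0 ord0.

Lemma invmx_corner_gt0 : 0 < a.
Proof. exact/posdefmx_diag_gt0/posdefmx_inv. Qed.

Let PSym : P^T = P. Proof. by case: (posdefmx_inv PS). Qed.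

Let ulP : ulsubmx P = a%:M.
Proof. by rewrite [LHS]mx11_scalar !mxE; congr (P _ _)%:M; apply/val_inj. Qed.

Let urP : ursubmx P = (dlsubmx P)^T.
Proof. by rewrite trmx_dlsub PSym. Qed.

Let SP : (dlsubmx S *m a%:M + drsubmx S *m dlsubmx P = 0) *
  (dlsubmx S *m (dlsubmx P)^T + drsubmx S *m drsubmx P = 1%:M) *
  (ulsubmx S *m a%:M + ursubmx S *m dlsubmx P = 1%:M).
Proof.
have : S *m P = 1%:M by exact: mulmxV (posdefmx_unit PS).
rewrite -{1}[S]submxK -{1}[P]submxK mulmx_block scalar_mx_block ulP urP.
by move=> /eq_block_mx[e1 _ e2 e3]; rewrite e1 e2 e3.
Qed.

(** Eliminating [dlsubmx S] between the two lower block equations of [S *m P = 1%:M] shows that the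
    Schur complement of [a] in [P] inverts the lower right block of [S]. *)
Lemma invmx_drsub : invmx (drsubmx S) =
  drsubmx P - a^-1 *: (dlsubmx P *m (dlsubmx P)^T).
Proof.
have a0 : a != 0 by rewrite gt_eqF// invmx_corner_gt0.
have uS := posdefmx_unit (posdefmx_drsub PS).
apply: (can_inj (mulKmx uS)); rewrite mulmxV//.
rewrite mulmxBr -scalemxAr mulmxA.
have -> : drsubmx S *m dlsubmx P = - (dlsubmx S *m a%:M).
  by apply/eqP; rewrite -addr_eq0 addrC SP.
rewrite mul_mx_scalar mulNmx -scalemxAl scalerN scalerA mulVf// scale1r opprK.
by rewrite addrC SP.
Qed.

(** Multiplying [S] by the identity matrix with its first column replaced by that of [P] gives a
    block triangular matrix; the determinants of both factors are immediate. *)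
Lemma det_drsub : \det S * a = \det (drsubmx S).
Proof.
have /(congr1 determinant) : S *m block_mx a%:M 0 (dlsubmx P) 1%:M =
    block_mx 1%:M (ursubmx S) 0 (drsubmx S).
  by rewrite -[S in S *m _]submxK mulmx_block !SP !mulmx0 !mulmx1 !add0r.
by rewrite det_mulmx det_lblock det_ublock det_scalar expr1 !det1 mul1r mulr1.
Qed.

(** Completion of the square in the first variable; what remains is the Schur complement, identified
    by [invmx_drsub]. *)
Lemma quad_schur (x0 : R) (y : 'cV[R]_n) :
  let x : 'cV[R]_(1 + n) := col_mx x0%:M y in
  (x^T *m P *m x) 0 0 =
    a * (x0 + a^-1 * ((dlsubmx P)^T *m y) 0 0) ^+ 2 +
    (y^T *m invmx (drsubmx S) *m y) 0 0.
Proof.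
have a0 : a != 0 by rewrite gt_eqF// invmx_corner_gt0.
move=> x; rewrite /x -[P in _ *m P *m _]submxK tr_col_mx mul_row_block
    mul_row_col.
rewrite invmx_drsub ulP urP tr_scalar_mx.
set b := dlsubmx P; set D := drsubmx P.
pose u := (b^T *m y) 0 0; pose v := (y^T *m D *m y) 0 0.
have bu : b^T *m y = u%:M by rewrite [LHS]mx11_scalar.
have ub : y^T *m b = u%:M by rewrite -[LHS]trmxK trmx_mul trmxK bu tr_scalar_mx.
have vE : y^T *m D *m y = v%:M by rewrite [LHS]mx11_scalar.
rewrite !mulmxDl mulmxBr mulmxBl -scalemxAr -scalemxAl !mulmxA vE ub.
rewrite -!(mulmxA _ b^T) bu -!scalar_mxM !mxE eqxx !mulr1n.
by field.
Qed.

End schur_complement.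

Lemma posdefmx_det_gt0 n (S : 'M[R]_n) : posdefmx S -> 0 < \det S.
Proof.
elim: n S => [|n IH] S PS; first by rewrite det_mx00.
have := IH _ (posdefmx_drsub (PS : posdefmx (S : 'M[R]_(1 + n)))).
by rewrite -det_drsub// pmulr_lgt0// invmx_corner_gt0.
Qed.

End posdef.

Section gauss_marginal.
Variable R : realType.

Lemma vconsE n (a : R) (y : 'cV[R]_n) :
    vcons (a, y) = col_mx a%:M y :> 'cV_(1 + n).
Proof.
apply/matrixP => i j; rewrite ord1 !mxE; case: splitP => k.
  rewrite !ord1 => k0; rewrite !mxE eqxx mulr1n.
  by rewrite (_ : i = 0) ?unlift_none//; exact/val_inj.
move=> ik; rewrite (_ : i = lift 0 k) ?liftK ?ord1//.
exact/val_inj.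
Qed.

Lemma powRN12 (x : R) : 0 <= x -> x `^ (- 2^-1) = (Num.sqrt x)^-1.
Proof. by move=> x0; rewrite powRN powR12_sqrt. Qed.

(* Conditionally on the other coordinates the first one is Gaussian: its mean
   and variance come from the Schur complement, and the other coordinates keep
   the covariance [drsubmx S]. *)
Lemma gauss_pdf_vcons n (S : 'M[R]_(1 + n)) (a : R) (y : 'cV[R]_n) :
  posdefmx S ->
  gauss_pdf S (vcons (a, y) : 'cV_(1 + n)) =
  normal_pdf (- ((invmx S ord0 ord0)^-1 * ((dlsubmx (invmx S))^T *m y) 0 0))
     (Num.sqrt (invmx S ord0 ord0)^-1) a * gauss_pdf (drsubmx S) y.
Proof.
move=> PS; rewrite vconsE /gauss_pdf quad_schur//.
have dS := det_drsub PS; have dS0 := posdefmx_det_gt0 (posdefmx_drsub PS).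
have al0 := invmx_corner_gt0 PS.
move: dS al0; set al := invmx S _ _ => dS al0.
have -> : \det S = \det (drsubmx S) * al^-1 by rewrite -dS mulfK// gt_eqF.
have pi2 : 0 < 2 * pi :> R by rewrite mulr_gt0// pi_gt0.
rewrite normal_pdfE ?gt_eqF ?sqrtr_gt0 ?invr_gt0//.
rewrite /normal_peak /normal_fun sqr_sqrtr ?invr_ge0 ?ltW//.
rewrite [(\det _ * _) `^ _]powRM ?invr_ge0 ?ltW//.
have -> : - ((1 + n)%:R / 2) = - 2^-1 - n%:R / 2 :> R by rewrite natrD; field.
rewrite powRD; last by rewrite (gt_eqF pi2) implybT.
rewrite [- 2^-1 * (_ + _)]mulrDr expRD.
have -> : (Num.sqrt (al^-1 * pi *+ 2))^-1 = (2 * pi) `^ (- 2^-1) * al^-1 `^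
    (- 2^-1).
  rewrite -powRM ?invr_ge0 ?ltW// powRN12 ?mulr_ge0 ?invr_ge0 ?pi_ge0 ?ltW//.
  by congr (Num.sqrt _)^-1; rewrite -mulr_natl; ring.
set t := (_ *m y) 0 0.
have -> : - (a - - (al^-1 * t)) ^+ 2 / (al^-1 *+ 2) = - 2^-1 * (al *
    (a + al^-1 * t) ^+ 2).
  by rewrite opprK; field; rewrite gt_eqF.
rewrite /=; ring.
Qed.

Local Open Scope ereal_scope.

Lemma integral_lebesgue_vecS n (f : 'cV[R]_n.+1 -> \bar R) :
  measurable_fun setT f -> (forall x, 0 <= f x) ->
  \int[lebesgue_vec R n.+1]_x f x =
  \int[lebesgue_vec R n]_y \int[lebesgue_measure]_a f (vcons (a, y)).
Proof.
move=> mf f0; rewrite /= /lebesgue_step ge0_integral_pushforward//=.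
- by rewrite fubini_tonelli2//=; apply: measurableT_comp => //;
    exact: measurable_vcons.
- exact: measurable_vcons.
Qed.

End gauss_marginal.

Section gauss_marginal.
Variable R : realType.
Local Open Scope ereal_scope.

Definition col_tail n (x : 'cV[R]_n.+1) :
    'cV[R]_n := (\col_i x (lift ord0 i) ord0)%R.

Lemma col_tail_vcons n (a : R) (y : 'cV[R]_n) : col_tail (vcons (a, y)) = y.
Proof. by apply/colP => i; rewrite !mxE liftK. Qed.

Lemma measurable_col_tail n : measurable_fun setT (@col_tail n).
Proof.
apply: measurable_fun_colvec => i.
rewrite (_ : (fun _ => _) = fun x : 'cV[R]_n.+1 => x (lift ord0 i) ord0).
  exact: measurable_coord.
by apply/funext => x; rewrite mxE.
Qed.

(** The conditional density of the first coordinate has mass one whatever its mean, so this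
    coordinate integrates out. *)
Lemma integral_gauss_pdf_tail n (S : 'M[R]_(1 + n)) (h : 'cV[R]_n -> \bar R) :
  posdefmx S -> measurable_fun setT h -> (forall y, 0 <= h y) ->
  \int[lebesgue_vec R n.+1]_x ((gauss_pdf S x)%:E * h (col_tail x)) =
  \int[lebesgue_vec R n]_y ((gauss_pdf (drsubmx S) y)%:E * h y).
Proof.
move=> PS mh h0; rewrite integral_lebesgue_vecS; last 2 first.
- apply: emeasurable_funM; first by apply/measurable_EFinP;
    exact: (measurable_gauss_pdf (S : 'M[R]_n.+1)).
  by apply: (measurableT_comp mh); exact: measurable_col_tail.
- by move=> x; rewrite mule_ge0// lee_fin gauss_pdf_ge0.
apply: eq_integral => y _.
under eq_integral => a _.
  rewrite col_tail_vcons (gauss_pdf_vcons a y PS) EFinM -muleA.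
  over.
rewrite ge0_integralZr//=.
- by rewrite integral_normal_pdf mul1e.
- by apply/measurable_EFinP; exact: measurable_normal_pdf.
- by move=> a _; rewrite lee_fin normal_pdf_ge0.
- by rewrite mule_ge0// lee_fin gauss_pdf_ge0.
Qed.

Lemma gauss_pdf0 (S : 'M[R]_0) x : gauss_pdf S x = 1%R.
Proof.
rewrite /gauss_pdf det_mx00 mul0r oppr0 powRr0 powR1 !mul1r mxE big_ord0.
by rewrite mulr0 expR0.
Qed.

Lemma gauss_setT n (S : 'M[R]_n) : posdefmx S -> gauss S setT = 1.
Proof.
elim: n S => [|n IH] S PS; rewrite /gauss.
  by under eq_integral do rewrite gauss_pdf0;
      rewrite integral_dirac//= diracT mul1e.
have := integral_gauss_pdf_tail (PS : posdefmx (S :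
    'M[R]_(1 + n))) (@measurable_cst _ _ _ _ setT 1) (fun=> lee01).
under eq_integral do rewrite mule1; move=> ->.
under eq_integral do rewrite mule1.
exact: IH (posdefmx_drsub _).
Qed.

(** Coordinates are removed from the front, which leaves the last one in place. In dimension one the
    Schur complement is [S] itself and the conditional density is the whole density. *)
Lemma gauss_marginal n (S : 'M[R]_n.+1) (A : set R) : posdefmx S ->
  measurable A ->
  gauss S ((fun x : 'cV[R]_n.+1 => x ord_max ord0) @^-1` A) =
  normal_prob 0 (Num.sqrt (S ord_max ord_max)) A.
Proof.
move=> PS mA; rewrite /gauss integral_mkcond.
have mc m : measurable_fun setT (fun x : 'cV[R]_m.+1 =>
    (\1_A (x ord_max ord0) : R)%:E).
  apply/measurable_EFinP; have m1 : measurable_fun setT (\1_A :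
      measurableTypeR R -> R) by exact: measurable_indic.
  by apply: (measurableT_comp m1); exact: measurable_coord.
have -> m (T : 'M[R]_m.+1) :
   ((fun x => (gauss_pdf T x)%:E) \_ ((fun x : 'cV[R]_m.+1 =>
       x ord_max ord0) @^-1` A)) =
   (fun x : 'cV[R]_m.+1 => (gauss_pdf T x)%:E * (\1_A (x ord_max ord0))%:E).
  by apply/funext => x; rewrite patchE indicE;
      rewrite (_ : (x \in _) = (x ord_max ord0 \in A)) ?mem_preimage//;
      case: ifPn => _; rewrite ?mule1 ?mule0.
elim: n => [|n IH] in S PS *; last first.
  rewrite -[ord_max](_ : lift ord0 ord_max = _); last exact/val_inj.
  have Sd : drsubmx (S : 'M[R]_(1 + n.+1)) ord_max ord_max =
            S (lift ord0 ord_max) (lift ord0 ord_max).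
    by rewrite !mxE; congr (S _ _); exact/val_inj.
  rewrite -Sd -(IH (drsubmx (S : 'M[R]_(1 + n.+1))));
      last exact: posdefmx_drsub.
  rewrite -integral_gauss_pdf_tail//.
  by apply: eq_integral => x _; rewrite mxE.
rewrite /normal_prob [RHS]integral_mkcond.
rewrite integral_lebesgue_vecS; last 2 first.
- apply: emeasurable_funM => //.
  by apply/measurable_EFinP; exact: measurable_gauss_pdf.
  exact: mc.
- by move=> x; apply: mule_ge0; rewrite lee_fin ?gauss_pdf_ge0.
transitivity (\int[lebesgue_vec R 0]_y cst (\int[lebesgue_measure]_a
    ((gauss_pdf S (vcons (a, 0%R : 'cV[R]_0)))%:E *
     (\1_A (vcons (a, 0%R : 'cV[R]_0) ord_max ord0))%:E)) y).
  by apply: eq_integral => y _; rewrite (flatmx0 y).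
rewrite integral_dirac//= diracT mul1e; apply: eq_integral => a _.
rewrite (gauss_pdf_vcons a 0 (PS : posdefmx (S :
    'M[R]_(1 + 0)))) gauss_pdf0 mulr1.
have : (\det S * (invmx S) ord0 ord0 = 1)%R.
  by rewrite (det_drsub (PS : posdefmx (S : 'M[R]_(1 + 0)))) det_mx00.
rewrite det_mx11 mulrC => /mulr1_eq ->.
rewrite mulmx0 mxE mulr0 oppr0 -[ord_max](_ : ord0 = _ :> 'I_1);
    last exact/val_inj.
rewrite mxE unlift_none /= patchE indicE.
by case: ifPn => _; rewrite ?mule1 ?mule0.
Qed.

End gauss_marginal.

(** * Characteristic function of the normal law *)

Section normal_char.
Variable R : realType.
Notation mu := (@lebesgue_measure R).

(** The normal density agrees almost everywhere with the Radon-Nikodym derivative, since both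
    integrate to [normal_prob] on every measurable set. *)
Lemma integral_normal_prob (m s : R) (f : R -> R) :
  (normal_prob m s).-integrable setT (EFin \o f) ->
  (\int[normal_prob m s]_x (f x)%:E =
   \int[mu]_x (f x * normal_pdf m s x)%:E)%E.
Proof.
move=> intf.
rewrite -(Radon_Nikodym_change_of_variables (normal_prob_dominates m s))//.
apply: ae_eq_integral => //.
- apply: emeasurable_funM; first exact: measurable_int intf.
  apply: (@measurable_int _ _ _ mu); apply: Radon_Nikodym_integrable.
  exact: normal_prob_dominates.
- apply/measurable_EFinP/measurable_funM; last exact: measurable_normal_pdf.
  by apply/measurable_EFinP; exact: measurable_int intf.
have : ae_eq mu setT (Radon_Nikodym (charge_of_finite_measure
    (normal_prob m s)) mu)
                     (EFin \o normal_pdf m s).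
  apply: integral_ae_eq => //.
  - by apply: Radon_Nikodym_integrable; exact: normal_prob_dominates.
  - by apply/measurable_EFinP; exact: measurable_normal_pdf.
  - move=> E _ mE; rewrite -Radon_Nikodym_integral//.
    exact: normal_prob_dominates.
by apply: filterS => x /(_ I) /= -> _.
Qed.

(** The integral over [-n, n] is G(n) - G(-n), which tends to zero; dominated convergence identifies
    its limit with the integral over the line. *)
Lemma integral_derivative_eq0 (G g : R -> R) :
  (forall x, is_derive x (1 : R) G (g x)) -> continuous g ->
  mu.-integrable setT (EFin \o g) ->
  G n%:R @[n --> \oo] --> (0 : R) -> G (- n%:R) @[n --> \oo] --> (0 : R) ->
  (\int[mu]_x (g x)%:E = 0)%E.
Proof.
move=> dG cg ig Gp Gn.
have mg : measurable_fun setT (EFin \o g) by exact: measurable_int ig.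
pose f_ (n : nat) : R -> \bar R := (EFin \o g) \_ `[(- n%:R)%R, n%:R%R].
have [|||||_ _ cvf] := @dominated_convergence _ _ _ mu setT measurableT f_
    (EFin \o g)
    (fun x => `|(g x)%:E|%E).
- by move=> n; apply/(measurable_restrictT _ _).1 => //;
    exact: measurable_funTS.
- exact: mg.
- apply: aeW => x _; apply: cvg_near_cst; near=> n.
  rewrite /f_ patchE ifT// inE/= in_itv/= -ler_norml.
  near: n; exact: nbhs_infty_ger.
- exact: integrable_abse.
- apply: aeW => x n _; rewrite /f_ patchE; case: ifPn => //= _.
  by rewrite normr0 lee_fin.
have : (fun n => (\int[mu]_x f_ n x)%E) @ \oo --> 0%E.
  rewrite [X in X @ _ --> _](_ : _ = fun n => (G n%:R - G (- n%:R))%:E).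
    apply: cvg_EFin; first exact: nearW.
    rewrite -[X in _ --> X](subr0 (0 : R)).
    by apply: cvgB; [exact: Gp|exact: Gn].
  apply/funext => n; rewrite -integral_mkcond.
  (* The fundamental theorem asks for a nondegenerate interval. *)
  have [->|n0] := eqVneq n 0.
    by rewrite oppr0 set_itv1 integral_set1 subrr.
  rewrite (@continuous_FTC2 _ g G)//.
  - by rewrite ltrNl -subr_gt0 opprK -natrD ltr0n addn_gt0 lt0n n0.
  - exact: continuous_subspaceT.
  - have cG : continuous G.
      by move=> x; apply/differentiable_continuous/derivable1_diffP;
          case: (dG x).
    split.
    + by move=> x _; case: (dG x).
    + by apply: cvg_at_right_filter; exact: cG.
    + by apply: cvg_at_left_filter; exact: cG.
  - by move=> x _; rewrite derive1E; case: (dG x).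
by move=> /(cvg_lim (@ereal_hausdorff R)) <-; apply/esym/cvg_lim.
Unshelve. all: end_near. Qed.

End normal_char.

Section is_derive_real.
Variable R : realType.
Implicit Types f g : R -> R.

Lemma is_derive1M f g (x a b : R) : is_derive x (1 : R) f a ->
  is_derive x (1 : R) g b ->
  is_derive x (1 : R) (fun y => f y * g y) (a * g x + f x * b).
Proof.
move=> df dg; have := is_deriveM df dg; congr (is_derive _ _ _ _).
by rewrite addrC; congr (_ + _); exact: mulrC.
Qed.

Lemma is_derive1D f g (x a b : R) : is_derive x (1 : R) f a ->
  is_derive x (1 : R) g b ->
  is_derive x (1 : R) (fun y => f y + g y) (a + b).
Proof. exact: is_deriveD. Qed.

Lemma is_derive_affine f (f' : R -> R) (xi b u : R) :
  (forall x, is_derive x (1 : R) f (f' x)) ->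
  is_derive u (1 : R) (fun x => f (xi * x + b)) (xi * f' (xi * u + b)).
Proof.
move=> df.
have da : is_derive u (1 : R) (fun x => xi * x + b) (0 * u + xi * 1 + 0).
  apply: is_derive1D; apply: is_derive1M.
have := is_derive1_comp (df _) da.
by congr (is_derive _ _ _ _); rewrite mul0r add0r addr0 mulr1 mulrC.
Qed.

Lemma is_derive1_continuous f (f' : R -> R) :
  (forall x, is_derive x (1 : R) f (f' x)) -> continuous f.
Proof.
by move=> df x; apply/differentiable_continuous/derivable1_diffP; case: (df x).
Qed.

End is_derive_real.

Section normal_char.
Variables (R : realType) (s : R).
Hypothesis s_gt0 : 0 < s.
Notation mu := (@lebesgue_measure R).
Let phi := normal_pdf 0 s.

Let s_neq0 : s != 0. Proof. by rewrite gt_eqF. Qed.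

Let phiE u : phi u = normal_peak s * expR (- u ^+ 2 / (s ^+ 2 *+ 2)).
Proof. by rewrite /phi normal_pdfE// /normal_fun subr0. Qed.

Let is_derive_phi (u : R) : is_derive u (1 : R) phi (- (u / s ^+ 2) * phi u).
Proof.
pose c := - (s ^+ 2 *+ 2)^-1.
have -> : phi = (fun x => normal_peak s * expR (c * (x * x))).
  by apply/funext => x; rewrite phiE /c; congr (_ * expR _); ring.
have dxx := is_derive1M (is_derive_id u (1 : R)) (is_derive_id u (1 : R)).
have := is_derive1M (is_derive_cst (normal_peak s) u (1 : R))
  (is_derive1_comp (is_derive_expR _) (is_derive1M (is_derive_cst c u (1 :
      R)) dxx)).
congr (is_derive _ _ _ _); rewrite /= /c -mulr_natr.
by field.
Qed.

Let integrable_mphi (f : R -> R) (C : R) : continuous f ->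
    (forall u, `|f u| <= C) ->
  mu.-integrable setT (EFin \o (fun u => f u * phi u)).
Proof.
move=> cf fC; apply: (@le_integrable _ _ _ mu _ measurableT _ (fun u =>
    C%:E * (phi u)%:E)%E).
- apply/measurable_EFinP/measurable_funM; last exact: measurable_normal_pdf.
  exact: continuous_measurable_fun.
- move=> u _; rewrite /= lee_fin !normrM ler_wpM2r//.
  by rewrite (le_trans (fC u))// ler_norm.
- by apply: integrableZl => //; exact: integrable_normal_pdf.
Qed.

(** [|u| * phi u] is dominated by a multiple of the normal density of twice the variance. With E =
    exp (- u^2 / (4 s^2)), [phi u] is [normal_peak s] times E^2; one factor E bounds [|u|] by 2 s
    and the other is the wider density up to its peak. *)
Let s' := Num.sqrt 2 * s.
Let C := 2 * s * normal_peak s / normal_peak s'.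

Let s'0 : s' != 0.
Proof. by rewrite mulf_neq0// gt_eqF// sqrtr_gt0. Qed.

Let C_ge0 : 0 <= C.
Proof. by rewrite /C !mulr_ge0 ?invr_ge0 ?normal_peak_ge0// ltW. Qed.

Let norm_phi_le u : `|u| * phi u <= C * normal_pdf 0 s' u.
Proof.
have s'2 : s' ^+ 2 = 2 * s ^+ 2 by rewrite exprMn sqr_sqrtr.
rewrite phiE normal_pdfE// /normal_fun subr0 s'2 /C.
set P := normal_peak s; set P' := normal_peak s'.
have P'0 : P' != 0 by rewrite gt_eqF// normal_peak_gt0.
have P0 : 0 <= P by exact: normal_peak_ge0.
set E := expR (- u ^+ 2 / (2 * s ^+ 2 *+ 2)).
have -> : expR (- u ^+ 2 / (s ^+ 2 *+ 2)) = E * E.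
  by rewrite -expRD; congr expR; field.
have -> : 2 * s * P / P' * (P' * E) = (2 * s) * (P * E) by field.
rewrite (_ : `|u| * _ = (`|u| * E) * (P * E)); last by ring.
rewrite ler_wpM2r ?mulr_ge0 ?expR_ge0//.
have E0 : 0 < E by exact: expR_gt0.
rewrite -ler_pdivlMr//.
have -> : E^-1 = expR (u ^+ 2 / (2 * s ^+ 2 *+ 2))
    by rewrite -expRN !mulNr opprK.
rewrite [leRHS]mulrC -ler_pdivrMr ?mulr_gt0//.
apply: (le_trans _ (expR_ge1Dx _)).
have -> : u ^+ 2 / (2 * s ^+ 2 *+ 2) = (`|u| / (2 * s)) ^+ 2.
  by rewrite expr_div_n real_normK ?num_real//; field.
(* What is left is y <= 1 + y^2. *)
set y := `|u| / _; nra.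
Qed.

Let integrable_id_phi : mu.-integrable setT (EFin \o (fun u => `|u| * phi u)).
Proof.
apply: (@le_integrable _ _ _ mu _ measurableT _ (fun u =>
    C%:E * (normal_pdf 0 s' u)%:E)%E).
- apply/measurable_EFinP/measurable_funM; last exact: measurable_normal_pdf.
  exact: normr_measurable.
- move=> u _; rewrite /= lee_fin [leRHS]ger0_norm; last first.
    by rewrite mulr_ge0 ?C_ge0 ?normal_pdf_ge0.
  by rewrite ger0_norm ?norm_phi_le// mulr_ge0 ?normal_pdf_ge0.
- by apply: integrableZl => //; exact: integrable_normal_pdf.
Qed.

Let cvg_phi (a : R ^nat) (f : R -> R) : (forall n, `|a n| = n%:R) ->
  (forall u, `|f u| <= 1) -> f (a n) * phi (a n) @[n --> \oo] --> (0 : R).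
Proof.
move=> an f1.
(* The two terms bound n phi(a n) and phi(a n), so M / (n + 1) bounds phi(a n). *)
pose M := C * normal_peak s' + normal_peak s.
have M0 : 0 <= M. apply: addr_ge0; [apply: mulr_ge0;
    [exact: C_ge0|exact: normal_peak_ge0]|exact: normal_peak_ge0].
have fphi n : `|f (a n) * phi (a n)| <= M * harmonic n.
  rewrite normrM (ger0_norm (normal_pdf_ge0 _ _ _)) -[leLHS]mul1r.
  rewrite mul1r (@le_trans _ _ (1 * phi (a n)))//.
    by rewrite ler_wpM2r ?normal_pdf_ge0.
  rewrite mul1r /= ler_pdivlMr ?ltr0Sn// -natr1 mulrDr mulr1 lerD//.
    rewrite -an mulrC (le_trans (norm_phi_le _))// ler_wpM2l ?C_ge0//.
    exact: normal_pdf_ub.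
  exact: normal_pdf_ub.
apply: norm_cvg0; apply: (@squeeze_cvgr _ _ _ _ (cst 0) (fun n =>
    M * harmonic n)).
- by near=> n; rewrite normr_ge0 fphi.
- exact: cvg_cst.
- rewrite -[X in _ --> X](mulr0 M); apply: cvgM; first exact: cvg_cst.
  exact: cvg_harmonic.
Unshelve. all: end_near. Qed.

Let continuous_phi : continuous phi.
Proof. exact: continuous_normal_pdf. Qed.

Let continuous_trig (f f' : R -> R) (xi b : R) :
  (forall x, is_derive x (1 : R) f (f' x)) -> continuous (fun u =>
      f (xi * u + b)).
Proof. by move=> df; apply: is_derive1_continuous => u;
    exact: is_derive_affine. Qed.

Let cos_le1 (x : R) : `|cos x| <= 1. Proof.
    by rewrite ler_norml cos_geN1 cos_le1. Qed.
Let sin_le1 (x : R) : `|sin x| <= 1. Proof.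
    by rewrite ler_norml sin_geN1 sin_le1. Qed.

Let continuous_c xi b : continuous (fun u : R => cos (xi * u + b)).
Proof. apply: (@continuous_trig _ _ xi b); exact: is_derive_cos. Qed.

Let continuous_s xi b : continuous (fun u : R => sin (xi * u + b)).
Proof. apply: (@continuous_trig _ _ xi b); exact: is_derive_sin. Qed.

Let integrable_c xi b : mu.-integrable setT (EFin \o (fun u =>
    cos (xi * u + b) * phi u)).
Proof. by apply: (@integrable_mphi _ 1); [exact: continuous_c|move=> u;
    exact: cos_le1]. Qed.

Let integrable_us xi b :
  mu.-integrable setT (EFin \o (fun u => u * sin (xi * u + b) * phi u)).
Proof.
apply: le_integrable integrable_id_phi => //.
  apply/measurable_EFinP/measurable_funM; last exact: measurable_normal_pdf.
  apply: measurable_funM => //; apply: continuous_measurable_fun.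
  exact: continuous_s.
move=> u _; rewrite /= lee_fin !normrM ler_wpM2r// normr_id.
by rewrite -[leRHS]mulr1 ler_wpM2l.
Qed.

(* The derivative of [sin (xi u + b) phi u] integrates to zero over the line. *)
Let parts xi b : \int[mu]_u (u * sin (xi * u + b) * phi u) =
  s ^+ 2 * xi * \int[mu]_u (cos (xi * u + b) * phi u).
Proof.
pose g u := (xi * s ^+ 2) * (cos (xi * u + b) * phi u) - u * sin
    (xi * u + b) * phi u.
have dG u : is_derive u (1 : R) (fun u =>
    s ^+ 2 * (sin (xi * u + b) * phi u)) (g u).
  have := is_derive1M (is_derive_cst (s ^+ 2) u (1 : R))
    (is_derive1M (is_derive_affine xi b u (@is_derive_sin R))
        (is_derive_phi u)).
  by congr (is_derive _ _ _ _); rewrite /g /=; field.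
have cg : continuous g.
  move=> u; apply: cvgB; apply: cvgM;
      [exact: cvg_cst| |apply: cvgM|exact: continuous_phi].
  - by apply: cvgM; [exact: continuous_c|exact: continuous_phi].
  - exact: cvg_id.
  - exact: continuous_s.
have ig1 : mu.-integrable setT (EFin \o (fun u =>
    (xi * s ^+ 2) * (cos (xi * u + b) * phi u))).
  exact: (integrableZl measurableT (xi * s ^+ 2) (integrable_c xi b)).
have ig : mu.-integrable setT (EFin \o g).
  by have := integrableB measurableT ig1 (integrable_us xi b).
have G0 (a : R ^nat) : (forall n, `|a n| = n%:R) ->
    s ^+ 2 * (sin (xi * a n + b) * phi (a n)) @[n --> \oo] --> (0 : R).
  move=> an; rewrite -[X in _ --> X](mulr0 (s ^+ 2)); apply: cvgM;
      first exact: cvg_cst.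
  by apply: (cvg_phi (f := fun u => sin (xi * u + b))) => // u; exact: sin_le1.
have : \int[mu]_u g u = 0.
  rewrite /Rintegral (integral_derivative_eq0 dG cg ig)//.
  - by apply: G0 => n; rewrite ger0_norm.
  - by apply: (G0 (fun n => - n%:R)) => n; rewrite normrN ger0_norm.
rewrite (RintegralB measurableT ig1 (integrable_us xi b)).
rewrite (RintegralZl _ measurableT (integrable_c xi b)).
by move/eqP; rewrite subr_eq0 => /eqP <-; rewrite (mulrC xi).
Qed.

(** As a function of xi the integral K satisfies K' = - s^2 xi K, by differentiation under the
    integral sign and [parts]. Hence exp (s^2 xi^2 / 2) K is constant, with value cos b at xi = 0.
    The phase b keeps the computation real. *)
Lemma normal_pdf_char xi b :
  \int[mu]_u (cos (xi * u + b) * phi u) = expR (-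
      (xi ^+ 2 * s ^+ 2 / 2)) * cos b.
Proof.
pose F (x u : R) : R := cos (x * u + b) * phi u.
pose K (x : R) := \int[mu]_u (cos (x * u + b) * phi u).
have df (x u : R) : is_derive x (1 :
    R) (F^~ u) (- (u * sin (x * u + b) * phi u)).
  have := is_derive1M (is_derive_affine u b x (@is_derive_cos R))
      (is_derive_cst (phi u) x (1 : R)).
  rewrite (_ : (fun y => _) = F^~ u); last first.
    by apply/funext => y; rewrite /F /= (mulrC u).
  by congr (is_derive _ _ _ _); rewrite /= (mulrC u x); ring.
have dK (x : R) : is_derive x (1 : R) K (- (s ^+ 2 * x * K x)).
  have xI : `]x - 1, x + 1[%classic x
      by rewrite /= in_itv/= ltrBlDr ltrDl ltr01.
  have int1 (y : R) : `]x - 1, x + 1[%classic y ->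
      mu.-integrable setT (EFin \o F y).
    by move=> _; exact: integrable_c.
  have der (y u : R) : `]x - 1, x + 1[%classic y -> setT u ->
      derivable (F^~ u) y 1.
    by move=> _ _; case: (df y u).
  have ub (y u : R) : `]x - 1, x + 1[%classic y -> setT u ->
      `|partial1of2 F y u| <= `|u| * phi u.
    move=> _ _; rewrite partial1of2E; case: (df y u) => _ ->.
    rewrite normrN !normrM (ger0_norm
        (normal_pdf_ge0 _ _ _)) ler_wpM2r ?normal_pdf_ge0//.
    by rewrite -[leRHS]mulr1 ler_wpM2l.
  have G0 (u : R) : 0 <= `|u| * phi u by rewrite mulr_ge0// normal_pdf_ge0.
  apply: DeriveDef.
    exact: (derivable_under_integral measurableT xI int1 der G0
        integrable_id_phi ub).
  rewrite -derive1E (differentiation_under_integral measurableT xI int1 der G0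
      integrable_id_phi ub).
  rewrite -parts -mulN1r -(RintegralZl _ measurableT (integrable_us _ _)).
  apply: eq_Rintegral => u _; rewrite partial1of2E; case: (df x u) => _ ->.
  by rewrite mulN1r.
pose h x := expR (s ^+ 2 / 2 * (x * x)) * K x.
have dh (x : R) : is_derive x (1 : R) h 0.
  have dxx := is_derive1M (is_derive_id x (1 : R)) (is_derive_id x (1 : R)).
  have := is_derive1M (is_derive1_comp (is_derive_expR _)
     (is_derive1M (is_derive_cst (s ^+ 2 / 2) x (1 : R)) dxx)) (dK x).
  by congr (is_derive _ _ _ _); rewrite /=; field.
have := is_derive_0_is_cst xi 0 dh; rewrite /h !mulr0 expR0 mul1r.
have -> : K 0 = cos b.
  rewrite /K; under eq_Rintegral do rewrite mul0r add0r.
  rewrite (RintegralZl _ measurableT (integrable_normal_pdf _ _)).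
  by rewrite /Rintegral integral_normal_pdf mulr1.
rewrite -/(K xi) => <-; rewrite mulrA -expRD.
rewrite [X in expR X](_ : _ = 0); last by field.
by rewrite expR0 mul1r.
Qed.

End normal_char.

Section gauss_char.
Variables (R : realType) (n : nat) (S : 'M[R]_n.+1).
Hypothesis PS : posdefmx S.

Lemma gauss_bounded_integrable (f : 'cV[R]_n.+1 -> R) (C : R) :
  measurable_fun setT f -> (forall x, `|f x| <= C) ->
  (gauss S).-integrable setT (EFin \o f).
Proof.
move=> mf fC; apply: measurable_bounded_integrable => //.
  by rewrite [ltLHS](gauss_setT PS) ltry.
exists C; split; first exact: num_real.
by move=> M CM x _; apply: (le_trans (fC x)); exact: ltW.
Qed.

Lemma gauss_char w b :
  \int[gauss S]_y cos (w * y ord_max ord0 + b) =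
  expR (- (w ^+ 2 * S ord_max ord_max / 2)) * cos b.
Proof.
have Sm : 0 < S ord_max ord_max by exact: posdefmx_diag_gt0.
pose s := Num.sqrt (S ord_max ord_max).
have s0 : 0 < s by rewrite sqrtr_gt0.
pose F (u : R) : R := cos (w * u + b).
have mF : measurable_fun setT F.
  apply: continuous_measurable_fun.
  apply: (@is_derive1_continuous _ _ (fun u => w * - sin (w * u + b))) => u.
  by apply: (@is_derive_affine _ _ (fun x => - sin x)) => x;
      exact: is_derive_cos.
have F1 u : `|F u| <= 1 by rewrite ler_norml cos_geN1 cos_le1.
have mc : measurable_fun setT (fun y : 'cV[R]_n.+1 =>
    y ord_max ord0 : measurableTypeR R).
  exact: measurable_coord.
have intF : (gauss S).-integrable setT ((EFin \o F) \o (fun y =>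
    y ord_max ord0)).
  apply: (@gauss_bounded_integrable _ 1) => //; exact: measurableT_comp.
have <- : \int[normal_prob 0 s]_u F u = expR (-
    (w ^+ 2 * S ord_max ord_max / 2)) * cos b.
  rewrite -(sqr_sqrtr (ltW Sm)) -/s -normal_pdf_char// /Rintegral.
  rewrite integral_normal_prob//.
  apply: measurable_bounded_integrable => //.
    by rewrite (@le_lt_trans _ _ 1%E) ?probability_le1// ltry.
  exists 1; split; first exact: num_real.
  by move=> M CM x _; apply: (le_trans (F1 x)); exact: ltW.
rewrite /Rintegral; congr fine.
have mEF : measurable_fun setT (EFin \o (F : measurableTypeR R ->
    R)) by exact/measurable_EFinP.
rewrite -(integral_pushforward mc mEF intF measurableT).
apply: (@eq_measure_integral _ _ _ setT (normal_prob 0 s)) => A mA _.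
exact: gauss_marginal.
Qed.

End gauss_char.

(** * The matrix exponential *)

Section expmx.
Variables (R : realType) (n : nat).
Implicit Types (A B : 'M[R]_n) (s : R).

Lemma cvg_mx (u : ('M[R]_n)^nat) A :
  (forall i j, (u k i j) @[k --> \oo] --> A i j) -> u @ \oo --> A.
Proof.
move=> uA; move=> V [P AP PV].
have : \forall k \near \oo, forall ij :
    'I_n * 'I_n, P ij.1 ij.2 (u k ij.1 ij.2).
  by apply: filter_forall => -[i j]; exact: (uA i j).
by apply: filterS => k Pk; apply: PV => i j; exact: (Pk (i, j)).
Qed.

Lemma cvg_sum (I : Type) (r : seq I) (T : Type) (F : set_system T) (FF :
    Filter F)
    (f : I -> T -> R) (l : I -> R) : (forall i, f i x @[x --> F] --> l i) ->
  \sum_(i <- r) f i x @[x --> F] --> \sum_(i <- r) l i.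
Proof.
move=> fl; elim: r => [|i r IH].
  by rewrite big_nil; under eq_fun do rewrite big_nil; exact: cvg_cst.
by rewrite big_cons; under eq_fun do rewrite big_cons; apply: cvgD.
Qed.

(** Each entry of [expmx (s *: B)] is a scalar power series in s, to which convergence and termwise
    differentiation of real power series apply. *)
Let c B i j (k : nat) : R := (B ^+ k) i j / k`!%:R.

Lemma exprmxZ s B k : (s *: B) ^+ k = s ^+ k *: B ^+ k.
Proof.
elim: k => [|k IH]; first by rewrite !expr0 scale1r.
rewrite !exprS IH /GRing.mul /=.
by rewrite -scalemxAl -scalemxAr scalerA.
Qed.

Lemma norm_expr_mx_le B : exists2 b :
    R, 0 <= b & forall k i j, `|(B ^+ k) i j| <= b ^+ k.
Proof.
pose b : R := \sum_(ij : 'I_n * 'I_n) `|B ij.1 ij.2|.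
have b0 : 0 <= b by exact: sumr_ge0.
exists b => //; elim=> [|k IH] i j.
  by rewrite !expr0 mxE; case: eqP => _ /=; rewrite ?normr1 ?normr0.
rewrite !exprS mxE (le_trans (ler_norm_sum _ _ _))//.
rewrite (@le_trans _ _ (\sum_l `|B i l| * b ^+ k))//.
  by apply: ler_sum => l _; rewrite normrM ler_wpM2l.
rewrite -mulr_suml ler_wpM2r ?exprn_ge0// /b.
rewrite -(pair_bigA _ (fun i l => `|B i l|))/= [leRHS](bigD1 i)//= lerDl.
by apply: sumr_ge0 => i' _; exact: sumr_ge0.
Qed.

Let cvg_c B i j s : cvgn (pseries (c B i j) s).
Proof.
have [b b0 bB] := norm_expr_mx_le B.
apply: normed_cvg; apply: series_le_cvg (is_cvg_series_exp_coeff (b * `|s|)).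
- by move=> k; exact: normr_ge0.
- by move=> k; apply: exp_coeff_ge0; rewrite mulr_ge0.
- move=> k /=; rewrite /c /exp_coeff /= !normrM normrX normfV exprMn mulrAC.
  rewrite [`|k`!%:R|]ger0_norm// ler_wpM2r ?invr_ge0// ler_wpM2r ?exprn_ge0//.
Qed.

Lemma expmxE B s i j :
  expmx (s *: B) i j = limn (pseries (fun k => (B ^+ k) i j / k`!%:R) s).
Proof.
rewrite /expmx; set u := series _.
have uE k i' j' : u k i' j' = pseries (c B i' j') s k.
  rewrite /u /pseries /series /= summxE; apply: eq_bigr => l _.
  by rewrite exprmxZ !mxE /c; ring.
pose L : 'M[R]_n := \matrix_(i', j') limn (pseries (c B i' j') s).
have -> : limn u = L.
  apply/cvg_lim; first exact: norm_hausdorff.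
  apply: cvg_mx => i' j'; rewrite mxE.
  by under eq_fun do rewrite uE; exact: cvg_c.
by rewrite mxE.
Qed.

Lemma expmx_trmx B s : expmx (s *: B^T) = (expmx (s *: B))^T.
Proof.
apply/matrixP => i j; rewrite mxE !expmxE; congr (limn (pseries _ _)).
apply/funext => k; congr (_ / _).
have -> : (B^T) ^+ k = (B ^+ k)^T; last by rewrite mxE.
elim: k => [|k IH]; first by rewrite !expr0 trmx1.
by rewrite exprS IH exprSr /GRing.mul /= trmx_mul.
Qed.

Lemma expmx0 B : expmx (0 *: B) = 1%:M.
Proof.
apply/matrixP => i j; rewrite expmxE; apply/cvg_lim => //.
apply: cvg_near_cst; exists 1 => // -[//|k] _.
rewrite /pseries /series /= big_nat_recl// big1 ?addr0.
  by rewrite expr0 fact0 divr1 expr0 mulr1.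
by move=> l _; rewrite expr0n mulr0.
Qed.

(** Since B^(k+1) = B B^k, differentiating the coefficients amounts to multiplying by B on the left.
    The series differentiated once and twice are therefore linear combinations of convergent entry
    series. *)
Lemma is_derive_expmx B i j s :
  is_derive s (1 : R) (fun s => expmx (s *: B) i j) ((B *m expmx (s *: B)) i j).
Proof.
have dc i' j' : pseries_diffs (c B i' j') = fun k => \sum_l B i' l * c B l j' k.
  apply/funext => k; rewrite /pseries_diffs /c exprS mxE mulr_suml.
  rewrite factS natrM invfM mulr_sumr; apply: eq_bigr => l _; rewrite mulrA.
  field.
  by rewrite !pnatr_eq0 -lt0n fact_gt0 addrC natr1 pnatr_eq0.
have psum (N : nat) (a : 'I_n -> R) (f : 'I_n -> nat -> R) x :
    pseries (fun k => \sum_l a l * f l k) x = fun N =>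
        \sum_l a l * pseries (f l) x N.
  apply/funext => M; rewrite /pseries /series /=.
  under eq_bigr do rewrite mulr_suml.
  rewrite exchange_big /=; apply: eq_bigr => l _; rewrite mulr_sumr.
  by apply: eq_bigr => k _; rewrite mulrA.
have cdc i' j' x : pseries (pseries_diffs (c B i' j')) x @ \oo -->
    (B *m expmx (x *: B)) i' j'.
  rewrite dc psum// mxE; apply: cvg_sum => l; apply: cvgM; first exact: cvg_cst.
  by rewrite expmxE; exact: cvg_c.
rewrite -(cvg_lim _ (cdc i j s))//.
rewrite (_ : (fun s => _) = fun s => limn (pseries (c B i j) s)); last first.
  by apply/funext => x; rewrite expmxE.
(* Any point of modulus larger than that of s would serve; the series converge everywhere. *)
apply: (@pseries_snd_diffs _ _ (`|s| + 1)).
- exact: cvg_c.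
- by apply/cvg_ex; eexists; exact: cdc.
- rewrite dc; have -> : pseries_diffs (fun k => \sum_l B i l * c B l j k) =
     fun k => \sum_l B i l * pseries_diffs (c B l j) k.
    apply/funext => k; rewrite /pseries_diffs mulr_sumr; apply: eq_bigr => l _.
    by rewrite mulrCA.
  rewrite psum//; apply/cvg_ex; eexists; apply: cvg_sum => l.
  by apply: cvgM; [exact: cvg_cst|exact: cdc].
- by rewrite (ger0_norm (addr_ge0 _ _))// ltrDl.
Qed.

End expmx.

(** * Exponential decay of a Hurwitz flow *)

Section real_triangularization.
Variable R : realType.

Definition Remx m n (M : 'M[R[i]]_(m, n)) :
    'M[R]_(m, n) := map_mx (@complex.Re R) M.
Definition Immx m n (M : 'M[R[i]]_(m, n)) :
    'M[R]_(m, n) := map_mx (@complex.Im R) M.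

Lemma Re_sum (I : Type) (r : seq I) (f : I -> R[i]) :
  complex.Re (\sum_(i <- r) f i) = \sum_(i <- r) complex.Re (f i).
Proof. by elim/big_rec2: _ => // i x [a b] _ <-; case: (f i). Qed.

Lemma Im_sum (I : Type) (r : seq I) (f : I -> R[i]) :
  complex.Im (\sum_(i <- r) f i) = \sum_(i <- r) complex.Im (f i).
Proof. by elim/big_rec2: _ => // i x [a b] _ <-; case: (f i). Qed.

Lemma Remx_mul m n p (M : 'M[R[i]]_(m, n)) (N : 'M[R[i]]_(n, p)) :
  Remx (M *m N) = Remx M *m Remx N - Immx M *m Immx N.
Proof.
apply/matrixP => i j; rewrite !mxE Re_sum -sumrB; apply: eq_bigr => k _.
by rewrite !mxE; case: (M i k) => a b; case: (N k j).
Qed.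

Lemma Immx_mul m n p (M : 'M[R[i]]_(m, n)) (N : 'M[R[i]]_(n, p)) :
  Immx (M *m N) = Remx M *m Immx N + Immx M *m Remx N.
Proof.
apply/matrixP => i j; rewrite !mxE Im_sum -big_split; apply: eq_bigr => k _.
by rewrite !mxE; case: (M i k) => a b; case: (N k j).
Qed.

(* Schur's triangularization [P B = T P] over [R[i]] with [Q = P^-1], split into
   real and imaginary parts so that the flow of [B] stays real. *)
Lemma hurwitzmx_triangular n (B : 'M[R]_n) : (0 < n)%N -> hurwitzmx B ->
  exists Pr Pi Qr Qi Tr Ti : 'M[R]_n,
  [/\ Pr *m B = Tr *m Pr - Ti *m Pi, Pi *m B = Tr *m Pi + Ti *m Pr,
      Qr *m Pr - Qi *m Pi = 1%:M,
      forall i j : 'I_n, (i < j)%N -> Tr i j = 0 /\ Ti i j = 0 &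
      forall k, Tr k k < 0].
Proof.
move=> n0 hB; set A := map_mx (real_complex R) B in hB.
have [P /unitarymx_unit uP trigP] := Schur A n0.
pose T := P *m A *m invmx P.
have PA : P *m A = T *m P by rewrite /T mulmxKV.
have /is_trig_mxP trigT : is_trig_mx T.
  by move: trigP; rewrite /similar_to /= (conjumx _ uP).
have ReA : Remx A = B by apply/matrixP => i j; rewrite !mxE.
have ImA : Immx A = 0 by apply/matrixP => i j; rewrite !mxE.
exists (Remx P), (Immx P), (Remx (invmx P)), (Immx (invmx P)), (Remx T),
    (Immx T).
split.
- by rewrite -Remx_mul -PA Remx_mul ReA ImA mulmx0 subr0.
- by rewrite -Immx_mul -PA Immx_mul ReA ImA mulmx0 add0r.
- rewrite -Remx_mul mulVmx//; apply/matrixP => i j; rewrite !mxE.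
  by case: eqP.
- by move=> i j ij; rewrite [Remx T i j]mxE [Immx T i j]mxE trigT.
move=> k; rewrite [Remx T k k]mxE; apply: hB.
(* The diagonal of a triangular matrix consists of eigenvalues, and a left eigenvector v of T gives
   the left eigenvector v P of A. *)
have : eigenvalue T (T k k).
  rewrite eigenvalue_root_char char_poly_trig; last exact/is_trig_mxP.
  by rewrite (bigD1 k)//= rootM root_XsubC eqxx.
move=> /eigenvalueP[v vT v0]; apply/eigenvalueP; exists (v *m P).
  by rewrite -mulmxA PA mulmxA vT scalemxAl.
by apply: contra_neq v0 => /(congr1 (mulmx^~ (invmx P)));
    rewrite mulmxK// mul0mx.
Qed.

End real_triangularization.

Section lyapunov.
Variable R : realType.

(* The quadratic form [sum_k d^(2k) |y_k|^2], with [y = u + i v], is a Lyapunov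
   function for [y' = (Tr + i Ti) y]: each entry below the diagonal costs a
   factor [d], hence is absorbed by the diagonal when [d] is small. *)
Lemma lyapunov_triangular n (Tr Ti : 'M[R]_n) :
  (forall i j : 'I_n, (i < j)%N -> Tr i j = 0 /\ Ti i j = 0) ->
  (forall k, Tr k k < 0) ->
  exists d c : R, [/\ 0 < d, 0 < c & forall u v : 'I_n -> R,
    \sum_(k < n) d ^+ k ^+ 2 * (u k * (\sum_j (Tr k j * u j - Ti k j * v j)) +
                      v k * (\sum_j (Tr k j * v j + Ti k j * u j)))
    <= - c * \sum_(k < n) d ^+ k ^+ 2 * (u k ^+ 2 + v k ^+ 2)].
Proof.
move=> trigT diagT.
(* The default value 1 is positive, so c0 is positive for every n. *)
pose c0 : R := \big[Num.min/1]_k (- Tr k k).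
have c0_gt0 : 0 < c0 by apply: lt_bigmin => [|k _]; rewrite ?ltr01 ?oppr_gt0.
have c0T k : Tr k k <= - c0.
  by rewrite lerNr; exact: bigmin_le_cond.
pose M : R := 1 + \sum_i \sum_j (`|Tr i j| + `|Ti i j|).
have MT i j : `|Tr i j| <= M /\ `|Ti i j| <= M.
  suff H : `|Tr i j| + `|Ti i j| <= M.
    by split; apply: le_trans H; rewrite ?lerDl ?lerDr.
  rewrite /M (bigD1 i)//= (bigD1 j)//=.
  have s1 : 0 <= \sum_(l < n | l != j) (`|Tr i l| + `|Ti i l|).
    by apply: sumr_ge0 => l _; rewrite addr_ge0.
  have s2 : 0 <= \sum_(l < n | l != i) \sum_m (`|Tr l m| + `|Ti l m|).
    by apply: sumr_ge0 => l _; apply: sumr_ge0 => m _; rewrite addr_ge0.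
  lra.
have M_gt0 : 0 < M.
  by rewrite ltr_wpDr// sumr_ge0// => i _; rewrite sumr_ge0// => j _;
      rewrite addr_ge0.
(* Summed over k and j, the terms [M * d * (e k + e j)] give 2 n M d times the form; this choice
   keeps that within half of the gain c0 from the diagonal. *)
pose d := Num.min 1 (c0 / (4 * M * n.+1%:R)).
have d_gt0 : 0 < d by rewrite lt_min ltr01 divr_gt0// !mulr_gt0.
have d_le1 : d <= 1 by rewrite ge_min lexx.
have dM : 2 * n%:R * (M * d) <= c0 / 2.
  have : d * (4 * M * n.+1%:R) <= c0.
    by rewrite -ler_pdivlMr ?mulr_gt0// ge_min lexx orbT.
  have := ltr0Sn R n; rewrite -natr1 => n0 H.
  have : 0 <= M * d by rewrite mulr_ge0// ltW.
  nra.
exists d, (c0 / 2); split; rewrite ?divr_gt0// => u v.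
pose e (k : 'I_n) := d ^+ k ^+ 2 * (u k ^+ 2 + v k ^+ 2).
have e_ge0 k : 0 <= e k by rewrite mulr_ge0 ?addr_ge0 ?sqr_ge0.
pose t (k j : 'I_n) := d ^+ k ^+ 2 * (u k * (Tr k j * u j - Ti k j * v j) +
                      v k * (Tr k j * v j + Ti k j * u j)).
have tle k j : t k j <= (if j == k then - c0 * e k else 0) + M * d *
    (e k + e j).
  have Mde : 0 <= M * d * (e k + e j).
    by apply: mulr_ge0; [rewrite mulr_ge0// ltW|exact: addr_ge0].
  move: Mde; have [->|jk] := eqVneq j k => Mde.
    apply: (@le_trans _ _ (- c0 * e k)); last by rewrite lerDl.
    rewrite (_ : t k k = Tr k k * e k); last by rewrite /t /e; ring.
    by rewrite ler_wpM2r.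
  rewrite add0r; have [kj|] := ltnP k j.
    by have [T1 T2] := trigT _ _ kj;
        rewrite /t T1 T2 !mul0r subrr addr0 !mulr0 addr0 mulr0.
  move=> jk'; have jltk : (j < k)%N by rewrite ltn_neqAle jk' andbT.
  (* As j < k and d <= 1, the weight d^(2k) is at most d times d^k d^j: the spare factor d is the
     gain below the diagonal. The product [p k * p j] is then at most [e k + e j]. *)
  pose p (i : 'I_n) := d ^+ i * (`|u i| + `|v i|).
  have p0 i : 0 <= p i by rewrite mulr_ge0 ?exprn_ge0 ?addr_ge0// ltW.
  have p2 i : p i ^+ 2 <= 2 * e i.
    rewrite /p /e exprMn [leRHS]mulrCA ler_wpM2l ?sqr_ge0//.
    rewrite -(real_normK (num_real (u i))) -(real_normK (num_real (v i))).
    by have := sqr_ge0 (`|u i| - `|v i|); nra.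
  have tp : t k j <= M * d * (p k * p j).
    rewrite (@le_trans _ _ (d ^+ k ^+ 2 * (M * ((`|u k| + `|v k|) *
        (`|u j| + `|v j|)))))//.
      rewrite /t ler_wpM2l ?sqr_ge0//.
      have [MTr MTi] := MT k j.
      have H (a b x : R) : `|x| <= M -> a * (x * b) <= M * (`|a| * `|b|).
        move=> xM; rewrite (le_trans (ler_norm _))// !normrM mulrCA.
        by rewrite ler_wpM2r ?mulr_ge0.
      have := H (u k) (u j) _ MTr; have := H (v k) (v j) _ MTr.
      have MNi : `|- Ti k j| <= M by rewrite normrN.
      by have := H (u k) (v j) _ MNi; have := H (v k) (u j) _ MTi; lra.
    have -> : M * d * (p k * p j) = (d ^+ k * (d * d ^+ j)) *
      (M * ((`|u k| + `|v k|) * (`|u j| + `|v j|))) by rewrite /p; ring.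
    apply: ler_wpM2r.
      by apply: mulr_ge0; [exact: ltW|rewrite mulr_ge0// addr_ge0].
    rewrite expr2 ler_wpM2l ?exprn_ge0 ?(ltW d_gt0)// -exprS.
    by rewrite ler_wiXn2l// ltW.
  apply: (le_trans tp); rewrite ler_wpM2l ?mulr_ge0 ?(ltW M_gt0) ?(ltW d_gt0)//.
  have := p2 k; have := p2 j; have := sqr_ge0 (p k - p j); nra.
have -> : \sum_(k < n) d ^+ k ^+ 2 * (u k * (\sum_j
    (Tr k j * u j - Ti k j * v j)) +
   v k * (\sum_j (Tr k j * v j + Ti k j * u j))) = \sum_k \sum_j t k j.
  apply: eq_bigr => k _; rewrite -mulr_sumr [in RHS]big_split/=; congr (_ * _).
  by rewrite !mulr_sumr.
apply: (@le_trans _ _ (\sum_k \sum_j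
    ((if j == k then - c0 * e k else 0) + M * d * (e k + e j)))).
  by apply: ler_sum => k _; apply: ler_sum => j _; exact: tle.
pose E := \sum_k e k.
have E0 : 0 <= E by exact: sumr_ge0.
under eq_bigr => k _.
  rewrite big_split/= -big_mkcond big_pred1_eq -mulr_sumr big_split/=.
  rewrite sumr_const card_ord -/E; over.
rewrite big_split/= -!mulr_sumr big_split/= sumr_const card_ord sumrMnl -/E.
rewrite -(mulr_natl E).
by have := ler_wpM2r E0 dM; lra.
Qed.

End lyapunov.

Section expmx_decay.
Variable R : realType.

Lemma is_derive1_sum (I : Type) (r : seq I) (f : I -> R -> R) (df : I ->
    R) (x : R) :
  (forall i, is_derive x (1 : R) (f i) (df i)) ->
  is_derive x (1 : R) (fun y => \sum_(i <- r) f i y) (\sum_(i <- r) df i).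
Proof.
move=> fdf; elim: r => [|i r IH].
  rewrite big_nil (_ : (fun y => _) = cst 0); first exact: is_derive_cst.
  by apply/funext => y; rewrite big_nil.
rewrite big_cons (_ : (fun y => _) = fun y => f i y + \sum_(j <- r) f j y).
  exact: is_derive1D.
by apply/funext => y; rewrite big_cons.
Qed.

(** A Gronwall inequality: exp (c x) phi(x) has nonpositive derivative where the mean value theorem
    evaluates it, as everywhere else. *)
Lemma is_derive1_le_exp (phi dphi : R -> R) (c : R) :
  (forall x, is_derive x (1 : R) phi (dphi x)) ->
  (forall x, dphi x <= - c * phi x) ->
  forall s, 0 <= s -> phi s <= phi 0 * expR (- (c * s)).
Proof.
move=> dp dle s; rewrite le_eqVlt => /predU1P[<-|s0].
  by rewrite mulr0 oppr0 expR0 mulr1.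
pose h x := expR (c * x) * phi x.
pose dh x := c * expR (c * x) * phi x + expR (c * x) * dphi x.
have hdh (x : R) : is_derive x (1 : R) h (dh x).
  have dc := is_derive1M (is_derive_cst c x (1 : R)) (is_derive_id x (1 : R)).
  have := is_derive1M (is_derive1_comp (is_derive_expR _) dc) (dp x).
  by congr (is_derive _ _ _ _); rewrite /dh /=; ring.
have [x _ hs] := MVT s0 (fun x _ => hdh x)
  (continuous_subspaceT (is_derive1_continuous hdh)).
have : h s <= h 0.
  rewrite -subr_le0 hs subr0 mulr_le0_ge0 ?(ltW s0)//.
  rewrite /dh (mulrC c) -mulrA -mulrDr mulr_ge0_le0 ?expR_ge0//.
  by have := dle x; lra.
rewrite /h mulr0 expR0 mul1r -ler_pdivlMl ?expR_gt0//.
by rewrite -expRN mulrC.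
Qed.

(** Each column of U + i V = P e^(sB) solves the triangular system, so its Lyapunov form [phi j]
    decays at rate 2 c and its entries at rate c. Multiplication by the inverse of P, whose parts
    are [Qr] and [Qi], returns to e^(sB). *)
Lemma expmx_decay n (B : 'M[R]_n) : (0 < n)%N -> hurwitzmx B ->
  exists C c : R, [/\ 0 <= C, 0 < c &
    forall s i j, 0 <= s -> `|expmx (s *: B) i j| <= C * expR (- (c * s))].
Proof.
move=> n0 hB.
have [Pr [Pi [Qr [Qi [Tr [Ti [PrB PiB QP trigT diagT]]]]]]] :=
    hurwitzmx_triangular n0 hB.
have [d [c [d0 c0 lyap]]] := lyapunov_triangular trigT diagT.
pose U s := Pr *m expmx (s *: B); pose V s := Pi *m expmx (s *: B).
pose phi j s := \sum_(k < n) d ^+ k ^+ 2 * (U s k j ^+ 2 + V s k j ^+ 2).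
have dU (P : 'M[R]_n) (k j : 'I_n) (s : R) :
    is_derive s (1 : R) (fun s =>
        (P *m expmx (s *: B)) k j) ((P *m B *m expmx (s *: B)) k j).
  rewrite (_ : (fun s => _) = fun s => \sum_l P k l * expmx (s *: B) l j);
      last first.
    by apply/funext => y; rewrite mxE.
  rewrite -mulmxA mxE; apply: is_derive1_sum => l.
  have := is_derive1M (is_derive_cst (P k l) s (1 :
      R)) (is_derive_expmx B l j s).
  by rewrite mul0r add0r.
have dphi j s : is_derive s (1 : R) (phi j) (2 * \sum_(k < n) d ^+ k ^+ 2 *
    (U s k j * (\sum_l (Tr k l * U s l j - Ti k l * V s l j)) +
     V s k j * (\sum_l (Tr k l * V s l j + Ti k l * U s l j)))).
  rewrite mulr_sumr; apply: is_derive1_sum => k.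
  have d2 f (f' : R) : is_derive s (1 : R) f f' ->
      is_derive s (1 : R) (fun s => f s ^+ 2) (2 * (f s * f')).
    move=> df; rewrite (_ : (fun s => _) = fun s => f s * f s); last first.
      by apply/funext => y; rewrite expr2.
    by have := is_derive1M df df; congr (is_derive _ _ _ _); ring.
  have := is_derive1M (is_derive_cst (d ^+ k ^+ 2) s (1 : R))
    (is_derive1D (d2 _ _ (dU Pr k j s)) (d2 _ _ (dU Pi k j s))).
  congr (is_derive _ _ _ _);
      rewrite mul0r add0r /= PrB PiB mulmxBl mulmxDl -!mulmxA.
  rewrite -/(U s) -/(V s) !mxE -mulrDr mulrCA;
      congr (_ * (_ * (_ * _ + _ * _))).
    by rewrite -sumrB.
  by rewrite -big_split.
have phiD j s : 0 <= s -> phi j s <= phi j 0 * expR (- ((2 * c) * s)).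
  apply: (is_derive1_le_exp (dphi j)) => x.
  have := lyap (fun k => U x k j) (fun k => V x k j); rewrite -/(phi j x); lra.
have phi_ge0 j s : 0 <= phi j s.
  by apply: sumr_ge0 => k _; rewrite mulr_ge0 ?addr_ge0 ?sqr_ge0.
(* [D] and [q] sum over all indices so that one constant serves every entry. *)
pose D := \sum_j \sum_(k < n) Num.sqrt (phi j 0) / d ^+ k.
pose q := \sum_i \sum_k (`|Qr i k| + `|Qi i k|).
have D_ge0 : 0 <= D.
  by apply: sumr_ge0 => j _; apply: sumr_ge0 => k _;
      rewrite divr_ge0 ?sqrtr_ge0 ?exprn_ge0 ?ltW.
have q_ge0 : 0 <= q.
  by apply: sumr_ge0 => j _; apply: sumr_ge0 => k _; rewrite addr_ge0.
have UVD s k j : 0 <= s -> `|U s k j| <= D * expR (-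
    (c * s)) /\ `|V s k j| <= D * expR (- (c * s)).
  move=> s0.
  have H x : d ^+ k ^+ 2 * x ^+ 2 <= phi j s -> `|x| <= D * expR (- (c * s)).
    move=> dx; rewrite (@le_trans _ _ (Num.sqrt (phi j 0) / d ^+ k * expR (-
        (c * s))))//; last first.
      rewrite ler_wpM2r ?expR_ge0// /D (bigD1 j)//= (bigD1 k)//=.
      rewrite -addrA lerDl addr_ge0//.
        by apply: sumr_ge0 => l _; rewrite divr_ge0 ?sqrtr_ge0 ?exprn_ge0 ?ltW.
      apply: sumr_ge0 => m _; apply: sumr_ge0 => l _.
      by rewrite divr_ge0 ?sqrtr_ge0 ?exprn_ge0 ?ltW.
    rewrite mulrAC ler_pdivlMr ?exprn_gt0//
        -[leLHS]ger0_norm ?mulr_ge0 ?exprn_ge0 ?(ltW d0)//.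
    rewrite normrM normr_id [`|d ^+ k|]ger0_norm ?exprn_ge0 ?(ltW d0)//.
    rewrite -ler_sqr ?nnegrE ?mulr_ge0 ?sqrtr_ge0 ?expR_ge0 ?exprn_ge0 ?(ltW
        d0)//.
    rewrite [leRHS]exprMn sqr_sqrtr//
        -expRM_natl mulrC exprMn real_normK ?num_real//.
    rewrite [leLHS]mulrC.
    rewrite mulrC in dx; apply: (le_trans dx); apply: (le_trans (phiD j s s0)).
    rewrite ler_wpM2l// ler_expR; lra.
  have phi1 : d ^+ k ^+ 2 * (U s k j ^+ 2 + V s k j ^+ 2) <= phi j s.
    rewrite /phi [leRHS](bigD1 k)//= lerDl; apply: sumr_ge0 => l _.
    by rewrite mulr_ge0 ?addr_ge0 ?sqr_ge0.
  by split; apply: H; apply: le_trans phi1;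
      rewrite ler_wpM2l ?sqr_ge0// ?lerDl ?lerDr sqr_ge0.
exists (q * D), c; split=> //; first exact: mulr_ge0.
move=> s i j s0.
have -> : expmx (s *: B) = Qr *m U s - Qi *m V s.
  by rewrite !mulmxA -mulmxBl QP mul1mx.
rewrite !mxE -sumrB (le_trans (ler_norm_sum _ _ _))//.
rewrite (@le_trans _ _ (\sum_k (`|Qr i k| + `|Qi i k|) * (D * expR (-
    (c * s)))))//.
  apply: ler_sum => k _; have [Ud Vd] := UVD s k j s0.
  by rewrite (le_trans (ler_normB _ _))// !normrM mulrDl lerD// ler_wpM2l.
rewrite -mulr_suml -mulrA ler_wpM2r ?mulr_ge0 ?expR_ge0//.
rewrite /q [leRHS](bigD1 i)//= lerDl.
by apply: sumr_ge0 => l _; apply: sumr_ge0 => m _; rewrite addr_ge0.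
Qed.

End expmx_decay.

(** * The covariance matrices *)

Section covmx.
Variables (R : realType) (n : nat) (Q B : 'M[R]_n).
Hypotheses (n_gt0 : (0 < n)%N) (PQ : posdefmx Q) (HB : hurwitzmx B).
Notation mu := (@lebesgue_measure R).

Let D (t : \bar R) : set (measurableTypeR R) := [set s :
    R | (0 <= s%:E <= t)%E].
Let g (s : R) : 'M[R]_n := expmx (s *: B) *m Q *m expmx (s *: B^T).

Lemma measurable_covmx_domain t : measurable (D t).
Proof.
case: t => [t| |].
- by rewrite (_ : D _ = `[0, t]%classic).
- rewrite (_ : D _ = `[0, +oo[%classic)//; apply/seteqP.
  by split=> s /=; rewrite /D /= in_itv/= ?leey ?andbT ?lee_fin.
- rewrite (_ : D _ = set0)//; apply/seteqP; split=> s //=.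
  by rewrite /D /= leeNy_eq andbF.
Qed.

Let gE s i j : g s i j = \sum_k (\sum_l expmx (s *:
    B) i l * Q l k) * expmx (s *: B) j k.
Proof.
rewrite /g expmx_trmx mxE; apply: eq_bigr => k _; rewrite !mxE.
by congr (_ * _).
Qed.

Let continuous_g i j : continuous (fun s => g s i j).
Proof.
have cE k l : continuous (fun s : R => expmx (s *: B) k l).
  exact: is_derive1_continuous (fun s => is_derive_expmx B k l s).
rewrite (_ : (fun s => _) = fun s =>
    \sum_k (\sum_l expmx (s *: B) i l * Q l k) * expmx (s *: B) j k).
  move=> s; apply: cvg_sum => k; apply: cvgM; last exact: cE.
  by apply: cvg_sum => l; apply: cvgM; [exact: cE|exact: cvg_cst].
by apply/funext => s; rewrite gE.
Qed.

(** Decay makes the integrand integrable up to +oo, so that [covmx Q B +oo] is a genuine integral;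
    the constant K also bounds the integrand for short times. *)
Let g_decay : exists K c : R, [/\ 0 <= K, 0 < c &
  forall s i j, 0 <= s -> `|g s i j| <= K * expR (- c * s)].
Proof.
have [C [c [C0 c0 Cc]]] := expmx_decay n_gt0 HB.
pose K := \sum_(k < n) \sum_(l < n) C * `|Q l k| * C.
exists K, (c + c); split; [|exact: addr_gt0|].
  by apply: sumr_ge0 => k _; apply: sumr_ge0 => l _; rewrite !mulr_ge0.
move=> s i j s0; rewrite gE (le_trans (ler_norm_sum _ _ _))// /K mulr_suml.
apply: ler_sum => k _; rewrite normrM mulr_suml.
have -> : - (c + c) * s = - (c * s) + - (c * s) by ring.
rewrite expRD.
apply: (@le_trans _ _ ((\sum_l (C * expR (- (c * s)) * `|Q l k|)) * (C * expR
    (- (c * s))))).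
  apply: ler_pM => //; last exact: Cc.
  rewrite (le_trans (ler_norm_sum _ _ _))//; apply: ler_sum => l _.
  by rewrite normrM ler_wpM2r// Cc.
by rewrite mulr_suml; apply: ler_sum => l _; rewrite le_eqVlt; apply/orP; left;
    apply/eqP; ring.
Qed.

Let integrable_g t i j : mu.-integrable (D t) (EFin \o (fun s => g s i j)).
Proof.
have [K [c [K0 c0 gK]]] := g_decay.
apply: (@le_integrable _ _ _ mu _ _ _ (fun s =>
    (K / c)%:E * (exponential_pdf c s)%:E)%E).
- exact: measurable_covmx_domain.
- apply/measurable_EFinP; apply: measurable_funTS.
  by apply: continuous_measurable_fun; exact: continuous_g.
- move=> s /= /andP[]; rewrite lee_fin => s0 _.
  rewrite lee_fin (le_trans (gK s i j s0))// exponential_pdfE//.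
  rewrite mulrA divfK ?gt_eqF// ler_norm//.
- apply: integrableZl; first exact: measurable_covmx_domain.
  apply: (@integrableS _ _ _ mu setT) => //;
      first exact: measurable_covmx_domain.
  exact: integrable_exponential_pdf.
Qed.

Lemma Rintegral_sum d (T : measurableType d) (nu : {measure set T -> \bar R})
    (A : set T) (I : Type) (r : seq I) (f : I -> T -> R) : measurable A ->
  (forall i, nu.-integrable A (EFin \o f i)) ->
  nu.-integrable A (EFin \o (fun x => \sum_(i <- r) f i x)) /\
  \int[nu]_(x in A) (\sum_(i <- r) f i x) = \sum_(i <- r) \int[nu]_(x in A) f i
      x.
Proof.
move=> mA intf; elim: r => [|i r [IH1 IH2]].
  rewrite big_nil; split.
    rewrite (_ : _ \o _ = cst 0%E); first exact: integrable0.
    by apply/funext => x /=; rewrite big_nil.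
  by under eq_Rintegral do rewrite big_nil; rewrite Rintegral_cst// mul0r.
have E : (fun x => \sum_(j <- i :: r) f j x) = fun x =>
    f i x + \sum_(j <- r) f j x.
  by apply/funext => x; rewrite big_cons.
split; first by rewrite E; exact: (integrableD mA (intf i) IH1).
by rewrite E RintegralD// IH2 big_cons.
Qed.

Let quad (x : 'cV[R]_n) s := (x^T *m g s *m x) 0 0.

Let quadE x s : quad x s = \sum_j \sum_i x i 0 * x j 0 * g s i j.
Proof.
rewrite /quad mxE; apply: eq_bigr => j _; rewrite mxE mulr_suml.
by apply: eq_bigr => i _; rewrite mxE; ring.
Qed.

Let integrable_quad x t : mu.-integrable (D t) (EFin \o quad x) /\
  (x^T *m covmx Q B t *m x) 0 0 = \int[mu]_(s in D t) quad x s.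
Proof.
have mD := measurable_covmx_domain t.
have int1 i j : mu.-integrable (D t) (EFin \o (fun s =>
    x i 0 * x j 0 * g s i j)).
  exact: (integrableZl mD (x i 0 * x j 0) (integrable_g t i j)).
have H j := Rintegral_sum (index_enum 'I_n) mD (int1^~ j).
have [H1 H2] := Rintegral_sum (index_enum 'I_n) mD (fun j => (H j).1).
have -> : quad x = fun s => \sum_j \sum_i x i 0 * x j 0 * g s i j.
  by apply/funext => s; exact: quadE.
split=> //; rewrite H2 mxE; apply: eq_bigr => j _;
    rewrite (H j).2 mxE mulr_suml.
apply: eq_bigr => i _; rewrite !mxE (RintegralZl _ mD (integrable_g t i j)).
by rewrite mulrAC.
Qed.

Let quad_ge0 x s : 0 <= quad x s.
Proof.
have -> : quad x s = (((expmx (s *: B))^T *m x)^T *m Q *m ((expmx (s *: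
    B))^T *m x)) 0 0.
  by rewrite /quad /g expmx_trmx trmx_mul trmxK !mulmxA.
have [->|y0] := eqVneq ((expmx (s *: B))^T *m x) 0; first by rewrite mulmx0 mxE.
by case: PQ => _ /(_ _ y0) /ltW.
Qed.

(** The integrand [quad x] is nonnegative, continuous, and positive at 0, where e^(sB) is the
    identity; hence it stays above half of [quad x 0] on a short interval [0, r] within the
    domain. *)
Lemma covmx_posdef t : (0 < t)%E -> posdefmx (covmx Q B t).
Proof.
move=> t0; split.
  apply/matrixP => i j; rewrite !mxE; apply: eq_Rintegral => s _.
  rewrite -/(g s) -[in LHS](trmxK (g s)) mxE; congr (_ i j).
  by rewrite /g !expmx_trmx !trmx_mul trmxK mulmxA; case: PQ => ->.
move=> x x0; have [iq ->] := integrable_quad x t.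
have mD := measurable_covmx_domain t.
have q0 : 0 < quad x 0.
  by rewrite /quad /g !expmx0 mul1mx mulmx1; case: PQ => _; exact.
have cq : continuous (quad x).
  rewrite (_ : quad x = fun s => \sum_j \sum_i x i 0 * x j 0 * g s i j);
      last first.
    by apply/funext => s; exact: quadE.
  move=> s; apply: cvg_sum => j; apply: cvg_sum => i.
  by apply: cvgM; [exact: cvg_cst|exact: continuous_g].
have [e e0 eq] : exists2 e : R, 0 < e & forall s, 0 <= s <= e ->
    quad x 0 / 2 <= quad x s.
  have /cvgrPdist_le/(_ (quad x 0 / 2)) := cq 0.
  rewrite divr_gt0// => /(_ isT)[e /= e0 He].
  exists (e / 2) => [|s /andP[s0 se]]; first by rewrite divr_gt0.
  have se' : s < e by rewrite (le_lt_trans se)// ltr_pdivrMr//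
      mulr_natr mulr2n ltrDl.
  have /He : `|0 - s| < e by rewrite sub0r normrN ger0_norm.
  by rewrite ler_norml => /andP[_]; lra.
have [r [r0 re rt]] : exists r : R, [/\ 0 < r, r <= e & (r%:E <= t)%E].
  case: t t0 {iq mD} => [t| |]//; last by exists e; rewrite leey lexx.
  rewrite lte_fin => t0; exists (Num.min t e).
  by rewrite lt_min t0 e0 ge_min lexx orbT lee_fin ge_min lexx.
rewrite -lte_fin fineK; last exact: integrable_fin_num.
have sub : `[0, r]%classic `<=` D t.
  move=> s; rewrite /D /= in_itv/= => /andP[s0 sr]; rewrite lee_fin s0/=.
  by rewrite (le_trans _ rt)// lee_fin.
apply: (@lt_le_trans _ _ (\int[mu]_(s in `[0%R, r]) (quad x 0 / 2)%:E)%E).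
  rewrite integral_cst//= lebesgue_measure_itv/= lte_fin r0 oppr0 adde0 -EFinM
      lte_fin.
  by rewrite mulr_gt0// divr_gt0.
have mq A : measurable A -> measurable_fun A (EFin \o quad x).
  move=> mA; apply: measurable_funTS; apply/measurable_EFinP.
  exact: continuous_measurable_fun.
apply: (@le_trans _ _ (\int[mu]_(s in `[0%R, r]) (quad x s)%:E)%E).
  apply: ge0_le_integral => //.
  - by move=> s _; rewrite lee_fin divr_ge0// ltW.
  - exact: mq.
  - move=> s /=; rewrite in_itv/= => /andP[s0 sr]; rewrite lee_fin eq// s0/=.
    exact: le_trans re.
apply: ge0_subset_integral => //; first exact: mq.
by move=> s _; rewrite lee_fin quad_ge0.
Qed.

Lemma covmx_small : exists2 K : R, 0 <= K & forall (t : R) i, 0 < t ->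
  covmx Q B t%:E i i <= K * t.
Proof.
have [K [c [K0 c0 gK]]] := g_decay.
exists K => // t i t0; rewrite mxE.
have DE : D t%:E = `[0, t]%classic by [].
have mDt : (mu (D t%:E) < +oo)%E.
  by rewrite DE lebesgue_measure_itv/= lte_fin t0 oppr0 adde0 ltry.
apply: (@le_trans _ _ (\int[mu]_(s in `[0, t]) K)).
  apply: le_Rintegral.
  - exact: measurable_covmx_domain.
  - exact: integrable_g.
  - apply: measurable_bounded_integrable => //.
    + exact: measurable_covmx_domain.
    + exact: bounded_cst.
  - move=> s /andP[]; rewrite lee_fin => s0 _.
    rewrite (le_trans (ler_norm _))// (le_trans (gK s i i s0))//.
    by rewrite ler_piMr// -expR0 ler_expR mulNr oppr_le0 mulr_ge0// ltW.
by rewrite Rintegral_cst//= lebesgue_measure_itv/= lte_fin t0 oppr0 adde0.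
Qed.

End covmx.

(** * The semigroup on cosine sums *)

Section nonneg_integral.
Context d (T : measurableType d) (R : realType) (mu : {measure set T ->
    \bar R}).
Local Open Scope ereal_scope.

(* To be applied to the oscillation, a supremum over uncountably many times
   whose measurability is not at hand. *)
Lemma le_nnintegral (f g : T -> \bar R) :
  (forall x, 0 <= f x) -> (forall x, f x <= g x) ->
  \int[mu]_x f x <= \int[mu]_x g x.
Proof.
move=> f0 fg; rewrite !ge0_integralTE//; last by move=> x;
    exact: le_trans (fg x).
by apply: le_ereal_sup => _ [h hf <-]; exists h => // x; exact: le_trans (fg x).
Qed.

Lemma le_poweR (x y : \bar R) (r : R) : (0 <= r)%R -> 0 <= x -> x <= y ->
  x `^ r <= y `^ r.
Proof.
move=> r0 x0 xy; apply: gt0_ler_poweR => //; rewrite in_itv/= leey andbT//.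
exact: le_trans xy.
Qed.

(** A Chebyshev inequality in which only E, and not g, has to be measurable. *)
Lemma Lnorm_ge_cst (g : T -> \bar R) (E : set T) (a p : R) :
  (1 <= p)%R -> (0 <= a)%R -> measurable E -> (forall x, E x -> a%:E <= g x) ->
  a%:E * mu E `^ p^-1 <= 'N[mu]_p%:E [g].
Proof.
move=> p1 a0 mE ag; have p0 : (0 < p)%R by exact: lt_le_trans p1.
rewrite unlock -[a%:E]poweRe1; last by rewrite lee_fin.
rewrite -(@mulfV _ p) ?gt_eqF// poweRrM -poweRM ?poweR_ge0//.
apply: le_poweR; rewrite ?invr_ge0 ?(ltW p0) ?mule_ge0 ?poweR_ge0//.
rewrite (_ : _ * _ = \int[mu]_x ((a `^ p)%:E * (\1_E x)%:E)); last first.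
  rewrite ge0_integralZl//=; last 2 first.
  - by apply/measurable_EFinP; exact: measurable_indic.
  - by rewrite lee_fin powR_ge0.
  by rewrite integral_indic// setIT.
apply: le_nnintegral => x.
  by rewrite mule_ge0// lee_fin powR_ge0.
rewrite indicE; case: (boolP (x \in E)) => xE; last by rewrite mule0 poweR_ge0.
rewrite mule1 -poweR_EFin; apply: le_poweR; rewrite ?(ltW p0) ?lee_fin//.
by rewrite (le_trans (ag _ (set_mem xE)))// lee_abs.
Qed.

End nonneg_integral.

Section OU_cosine.
Variables (R : realType) (n : nat) (Q B : 'M[R]_n.+1).
Hypotheses (PQ : posdefmx Q) (HB : hurwitzmx B).

Definition last_coord (x : 'cV[R]_n.+1) : R := x ord_max ord0.
Definition cos_sum (s : seq R) (x : 'cV[R]_n.+1) : R :=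
  \sum_(w <- s) cos (w * last_coord x).
Definition var (t : \bar R) : R := covmx Q B t ord_max ord_max.
(** The characteristic function at w of the centred normal law of variance v; with v = (Q_t)_mm it
    is the multiplier of H_t at frequency w. *)
Definition damp (w v : R) : R := expR (- (w ^+ 2 * v / 2)).

Lemma var_gt0 t : (0 < t)%E -> 0 < var t.
Proof. by move=> t0; apply: posdefmx_diag_gt0; exact: covmx_posdef. Qed.

Lemma measurable_cos_coord (w b : R) :
  measurable_fun setT (fun x : 'cV[R]_n.+1 => cos (w * last_coord x + b)).
Proof.
have mc : measurable_fun setT (fun u : R => cos (w * u + b)).
  apply: continuous_measurable_fun.
  apply: (@is_derive1_continuous _ _ (fun u => w * - sin (w * u + b))) => u.
  by apply: (@is_derive_affine _ _ (fun x => - sin x)) => x;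
      exact: is_derive_cos.
by apply: (measurableT_comp mc); exact: measurable_coord.
Qed.

Lemma norm_cos_le1 (x : R) : `|cos x| <= 1.
Proof. by rewrite ler_norml cos_geN1 cos_le1. Qed.

(** For fixed x, the argument e^(tB) x only contributes a phase to the Gaussian average over y, so
    [gauss_char] applies with frequency -w and that phase. *)
Lemma OU_cos_sum (t : R) (s : seq R) x : 0 < t ->
  OU Q B t (cos_sum s) x =
  \sum_(w <- s) damp w (var t%:E) * cos (w * last_coord (expmx (t *: B) *m x)).
Proof.
move=> t0; set a := expmx (t *: B) *m x.
have PS : posdefmx (covmx Q B t%:E) by apply: covmx_posdef; rewrite ?lte_fin.
rewrite /OU -/a.
pose c w (y : 'cV[R]_n.+1) := cos (- w * last_coord y + w * last_coord a).
have intc w : (gauss (covmx Q B t%:E)).-integrable setT (EFin \o c w).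
  apply: (@gauss_bounded_integrable _ _ _ PS _ 1);
      first exact: measurable_cos_coord.
  by move=> y; exact: norm_cos_le1.
transitivity (\int[gauss (covmx Q B t%:E)]_y \sum_(w <- s) c w y).
  apply: eq_Rintegral => y _; rewrite /cos_sum; apply: eq_bigr => w _.
  by rewrite /c /last_coord !mxE; congr cos; ring.
rewrite (Rintegral_sum s measurableT intc).2; apply: eq_bigr => w _.
by rewrite gauss_char// sqrrN.
Qed.

End OU_cosine.

(** * Riesz products and lacunary sequences *)

Section riesz_products.
Variable R : realType.

Lemma damp_gt0 (w v : R) : 0 < damp w v. Proof. exact: expR_gt0. Qed.

Lemma damp_le1 (w v : R) : 0 <= v -> damp w v <= 1.
Proof.
by move=> v0; rewrite /damp -expR0 ler_expR oppr_le0 divr_ge0// mulr_ge0//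
    sqr_ge0.
Qed.

Lemma near_damp (v e : R) : 0 < v -> 0 < e ->
    \forall w \near +oo, damp w v <= e.
Proof.
move=> v0 e0; near=> w.
have w1 : 1 <= w by near: w; apply: nbhs_pinfty_ge; exact: num_real.
(* From exp z >= 1 + z the damping is at most 1 / (1 + w^2 v / 2); with w >= 1, the bound w v e >= 2
   makes this at most e. *)
have w2 : 2 / (v * e) <= w by near: w; apply: nbhs_pinfty_ge; exact: num_real.
rewrite /damp expRN -[leRHS]invrK lef_pV2 ?posrE ?expR_gt0 ?invr_gt0//.
apply: (le_trans _ (expR_ge1Dx _)).
have H2 : 2 <= w * (v * e) by rewrite -ler_pdivrMr// mulr_gt0.
rewrite -[leLHS]mul1r ler_pdivrMr//.
have : 0 <= (w - 1) * w * (v * e) by rewrite !mulr_ge0 ?subr_ge0 ?ltW//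
    (lt_le_trans ltr01 w1).
nra.
Unshelve. all: end_near. Qed.

Lemma cvg_damp (v : R) : 0 < v -> damp w v @[w --> +oo] --> (0 : R).
Proof.
move=> v0; apply/cvgrPdist_le => e e0; near=> w.
rewrite sub0r normrN ger0_norm ?(ltW (damp_gt0 _ _))//.
by near: w; exact: near_damp.
Unshelve. all: end_near. Qed.

Variables (n : nat) (S : 'M[R]_n.+1).
Hypothesis PS : posdefmx S.

(** The classical Riesz product has a = 1; the value a = 1 + 2 l^2 is used later, so that each
    factor dominates an exponential. *)
Definition riesz (a l : R) (s : seq R) (x : 'cV[R]_n.+1) : R :=
  \prod_(w <- s) (a + l * cos (w * last_coord x)).

Lemma measurable_cos_last (w : R) :
  measurable_fun setT (fun x : 'cV[R]_n.+1 => cos (w * last_coord x)).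
Proof.
rewrite (_ : (fun x => _) = fun x => cos (w * last_coord x + 0)).
  exact: measurable_cos_coord.
by apply/funext => x; rewrite addr0.
Qed.

Lemma measurable_riesz a l s : measurable_fun setT (riesz a l s).
Proof.
rewrite /riesz; elim: s => [|w s IH].
  by rewrite (_ : (fun x => _) = cst 1)//; apply/funext => x; rewrite big_nil.
rewrite (_ : (fun x => _) = fun x => (a + l * cos (w * last_coord x)) *
   \prod_(u <- s) (a + l * cos (u * last_coord x))); last first.
  by apply/funext => x; rewrite big_cons.
apply: measurable_funM => //; apply: measurable_funD => //.
by apply: measurable_funM => //; exact: measurable_cos_last.
Qed.

Lemma riesz_bounded a l s x : `|riesz a l s x| <= (`|a| + `|l|) ^+ size s.
Proof.
rewrite /riesz; elim: s => [|w s IH]; first by rewrite big_nil normr1.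
rewrite big_cons normrM exprS ler_pM// (le_trans (ler_normD _ _))// lerD2l.
by rewrite normrM -[leRHS]mulr1 ler_wpM2l// norm_cos_le1.
Qed.

Lemma integrable_riesz_cos a l s (w : R) : (gauss S).-integrable setT
  (EFin \o (fun x => riesz a l s x * cos (w * last_coord x))).
Proof.
apply: (@gauss_bounded_integrable _ _ _ PS _ ((`|a| + `|l|) ^+ size s)).
  apply: measurable_funM; first exact: measurable_riesz.
  exact: measurable_cos_last.
move=> x; rewrite normrM -[leRHS]mulr1 ler_pM ?riesz_bounded//.
exact: norm_cos_le1.
Qed.

Lemma gauss_cos (w : R) :
  \int[gauss S]_x cos (w * last_coord x) = damp w (S ord_max ord_max).
Proof.
rewrite /damp; have := gauss_char PS w 0; rewrite cos0 mulr1 => <-.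
by apply: eq_Rintegral => x _; rewrite addr0.
Qed.

(** A Riemann-Lebesgue lemma, by induction on the number of factors: the product formula for cosines
    turns one factor into the shifted frequencies w + u and w - u, which still tend to infinity.
    Without factors the integral is the characteristic function. *)
Lemma cvg_riesz a l s :
  \int[gauss S]_x (riesz a l s x * cos (w * last_coord x)) @[w --> +oo] -->
      (0 : R).
Proof.
elim: s => [|u s IH].
  apply: cvg_trans (cvg_damp (posdefmx_diag_gt0 ord_max PS)).
  apply: near_eq_cvg; near=> w; rewrite -gauss_cos.
  by apply: eq_Rintegral => x _; rewrite /riesz big_nil mul1r.
pose I w := \int[gauss S]_x (riesz a l s x * cos (w * last_coord x)).
have -> : (fun w => \int[gauss S]_x (riesz a l (u ::
    s) x * cos (w * last_coord x))) =
    fun w => a * I w + l / 2 * (I (w + u) + I (w - u)).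
  apply/funext => w; have J := integrable_riesz_cos a l s.
  rewrite -(RintegralZl _ measurableT (J w)).
  rewrite -(RintegralD measurableT (J (w + u)) (J (w - u))).
  have JD := integrableD measurableT (J (w + u)) (J (w - u)).
  rewrite -(RintegralZl _ measurableT JD).
  rewrite -(RintegralD measurableT (integrableZl measurableT a (J w))
     (integrableZl measurableT (l / 2) JD)).
  apply: eq_Rintegral => x _; rewrite /riesz big_cons.
  rewrite (mulrDl w u) (mulrBl _ w u) cosD cosB.
  set P := \prod_(_ <- _) _; set cw := cos (w * _); set cu := cos (u * _).
  by set sw := sin (w * _); set su := sin (u * _); field.
have Iu (v : R) : I (w + v) @[w --> +oo] --> (0 : R).
  by apply: cvg_comp IH; exact: cvg_addrr.
have E0 : a * 0 + l / 2 * (0 + 0) = 0 :> R by rewrite addr0 !mulr0 addr0.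
have cI : a * I w @[w --> +oo] --> a * 0 by apply: cvgM;
    [exact: cvg_cst|exact: IH].
have cD : I (w + u) + I (w - u) @[w --> +oo] --> 0 + 0 by apply: cvgD;
    exact: Iu.
have cL : l / 2 * (I (w + u) + I (w - u)) @[w --> +oo] --> l / 2 * (0 + 0).
  by apply: cvgM; [exact: cvg_cst|exact: cD].
by have := cvgD cI cL; rewrite E0; exact.
Unshelve. all: end_near. Qed.

End riesz_products.

(** * Alternating choice of times and frequencies *)

Section history.

(** Dependent choice on the whole history: [hist] accumulates the list of earlier choices, from
    which the next term is drawn. *)
Lemma history_choice (X : Type) (P : seq X -> X -> Prop) :
  (forall s, exists x, P s x) -> exists u : nat ->
      X, forall k, P (mkseq u k) (u k).
Proof.
move=> /choice[F PF].
pose hist := fix hist k := if k is k'.+1 then rcons (hist k') (F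
    (hist k')) else [::].
exists (fun k => F (hist k)) => k.
suff -> : mkseq (fun k => F (hist k)) k = hist k by exact: PF.
by elim: k => // k IH; rewrite mkseqS IH.
Qed.

Lemma near_all (X : eqType) (T : Type) (F : set_system T) (FF : Filter F) (s :
    seq X)
    (P : X -> T -> Prop) :
  (forall x, x \in s -> \forall w \near F, P x w) ->
  \forall w \near F, forall x, x \in s -> P x w.
Proof.
elim: s => [|y s IH] Ps; first by apply: nearW.
have H1 := Ps y (mem_head _ _).
have H2 := IH (fun x xs => Ps x (mem_behead (s := y :: s) xs)).
apply: filterS2 H1 H2 => w Pyw Psw x; rewrite inE => /predU1P[->//|];
    exact: Psw.
Qed.

End history.

Section lacunary.
Variables (R : realType) (n : nat) (Q B : 'M[R]_n.+1).
Hypotheses (PQ : posdefmx Q) (HB : hurwitzmx B).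

Lemma cos_lipschitz (a b : R) : `|cos a - cos b| <= `|a - b|.
Proof.
wlog ab : a b / a < b => [H|].
  have [/H//|/H|->] := ltgtP a b; last by rewrite !subrr.
  by rewrite distrC (distrC b).
have [c _ cE] := MVT ab (fun x _ =>
    is_derive_cos x) (continuous_subspaceT (@continuous_cos R)).
rewrite distrC cE normrM normrN distrC -[leRHS]mul1r ler_wpM2r//.
by rewrite ler_norml sin_geN1 sin_le1.
Qed.

Definition drift (t : R) : R := \sum_l `|expmx (t *: B) ord_max l - (1%:M :
    'M[R]_n.+1) ord_max l|.

Definition cube (r : R) (x : 'cV[R]_n.+1) := forall i, `|x i ord0| <= r.

Lemma last_coord_drift (r t : R) x : cube r x ->
  `|last_coord (expmx (t *: B) *m x) - last_coord x| <= drift t * r.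
Proof.
move=> xr; rewrite -[x in X in _ - X]mul1mx /last_coord !mxE -sumrB.
rewrite (le_trans (ler_norm_sum _ _ _))// mulr_suml; apply: ler_sum => l _.
by rewrite -mulrBl normrM ler_wpM2l.
Qed.

(** The first term is the loss of amplitude, the second the displacement of the argument. Both grow
    with w, which is why t must be chosen after the frequencies it has to preserve. *)
Lemma damp_cos_error (r t w : R) x : 0 < t -> cube r x ->
  `|damp w (var Q B t%:E) * cos (w * last_coord (expmx (t *:
      B) *m x)) - cos (w * last_coord x)|
  <= w ^+ 2 * var Q B t%:E + `|w| * (drift t * r).
Proof.
move=> t0 xr; set v := var _ _ _; set a' := last_coord (_ *m x);
    set a := last_coord x.
have v0 : 0 < v by apply: var_gt0 => //; rewrite lte_fin.
have -> : damp w v * cos (w * a') - cos (w * a) =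
    - ((1 - damp w v) * cos (w * a')) + (cos (w * a') - cos (w * a)) by ring.
rewrite (le_trans (ler_normD _ _))// lerD//; last first.
  rewrite (le_trans (cos_lipschitz _ _))// -mulrBr normrM ler_wpM2l//.
  exact: last_coord_drift.
have d1 := damp_le1 w (ltW v0).
rewrite normrN normrM ger0_norm ?subr_ge0// (@le_trans _ _ (1 - damp w v))//.
  by rewrite -[leRHS]mulr1 ler_wpM2l ?subr_ge0// norm_cos_le1.
have := expR_ge1Dx (- (w ^+ 2 * v / 2)); rewrite -/(damp w v).
have : 0 <= w ^+ 2 * v by rewrite mulr_ge0 ?sqr_ge0 ?ltW.
lra.
Qed.

Lemma small_time (eta tau : R) : 0 < eta -> 0 < tau ->
  exists t : R, [/\ 0 < t, t < tau, var Q B t%:E <= eta & drift t <= eta].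
Proof.
move=> eta0 tau0; have [K K0 HK] := covmx_small Q (ltn0Sn n) HB.
have cdrift : drift t @[t --> (0 : R)] --> (0 : R).
  have : drift t @[t --> (0 : R)] --> drift 0.
    apply: cvg_sum => l; apply: cvg_norm; apply: cvgB; last exact: cvg_cst.
    exact: (is_derive1_continuous (fun s => is_derive_expmx B ord_max l s)).
  rewrite {2}/drift big1// => l _; by rewrite expmx0 subrr normr0.
have [t [t0 [tt tK td]]] : exists t :
    R, 0 < t /\ [/\ t < tau, t <= eta / (K + 1) & drift t <= eta].
  near (0 : R)^'+ => t; exists t; split=> //; split.
  - by near: t; exact: nbhs_right_lt.
  - by near: t; apply: nbhs_right_le; rewrite divr_gt0// ltr_wpDl.
  - near: t; have /cvgrPdist_le/(_ _ eta0) := cvg_at_right_filter cdrift.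
    by apply: filterS => t; rewrite sub0r normrN; apply: le_trans;
        exact: ler_norm.
exists t; split=> //.
rewrite (le_trans (HK t _ t0))//.
have K1 : 0 < K + 1 by rewrite ltr_wpDl.
by move: tK; rewrite ler_pdivlMr//; nra.
Unshelve. all: end_near. Qed.

(** Within a step the time comes before the frequency: w_k must also be damped at the new time t_k,
    which is possible because the variance there is positive. Near orthogonality to the Riesz
    product is required for both signs, since |f| is controlled through exp (lam f) and exp (- lam
    f) together. *)
Lemma lacunary_sequences (r lam : R) : 0 <= r -> 0 < lam ->
  exists t w : nat -> R, [/\ forall k, 0 < t k <= 1,
    forall j k, (j < k)%N -> t k < t j,
    forall k x, cube r x ->
      `|\sum_(j < k) (damp (w j) (var Q B (t k)%:E) *
          cos (w j * last_coord (expmx (t k *: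
              B) *m x)) - cos (w j * last_coord x))| <= 1 / 16,
    forall j k, (j <= k)%N -> damp (w k) (var Q B (t j)%:E) <=
        (2 ^+ k * 32)^-1 &
    forall k, `|\int[gauss (covmx Q B +oo)]_x
        (riesz (1 + 2 * lam ^+ 2) lam (mkseq w k) x * cos
            (w k * last_coord x))| <= lam /\
      `|\int[gauss (covmx Q B +oo)]_x
        (riesz (1 + 2 * lam ^+ 2) (- lam) (mkseq w k) x * cos
            (w k * last_coord x))| <= lam].
Proof.
move=> r0 lam0; set mu := gauss (covmx Q B +oo).
have PS : posdefmx (covmx Q B +oo) by apply: covmx_posdef.
pose I (l : R) (s : seq R) (w : R) : R :=
  \int[mu]_x (riesz (1 + 2 * lam ^+ 2) l s x * cos (w * last_coord x)).
pose err (s : seq (R * R)) (t : R) (x : 'cV[R]_n.+1) : R := \sum_(p <- s)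
  (damp p.2 (var Q B t%:E) * cos (p.2 * last_coord (expmx (t *:
      B) *m x)) - cos (p.2 * last_coord x)).
(* The guards [0 < p.1] only serve to make [P s] satisfiable for every [s]. *)
pose P (s : seq (R * R)) (tw : R * R) : Prop :=
  [/\ 0 < tw.1 <= 1,
      forall p, p \in s -> 0 < p.1 -> tw.1 < p.1,
      forall x, cube r x -> `|err s tw.1 x| <= 1 / 16,
      forall p, p \in rcons s tw -> 0 < p.1 ->
          damp tw.2 (var Q B p.1%:E) <= (2 ^+ size s * 32)^-1 &
      `|I lam [seq p.2 | p <- s] tw.2| <= lam /\ `|I
          (- lam) [seq p.2 | p <- s] tw.2| <= lam].
have exP s : exists tw, P s tw.
  (* With variance and drift at most 1 / (16 c), the errors of [damp_cos_error] over the whole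
     history add up to at most 1/16. *)
  pose c := 1 + \sum_(p <- s) (p.2 ^+ 2 + `|p.2| * r).
  have c0 : 0 < c by rewrite ltr_wpDr// sumr_ge0// => p _;
      rewrite addr_ge0 ?sqr_ge0 ?mulr_ge0.
  have [tau [tau0 tau1 taus]] : exists tau : R, [/\ 0 < tau, tau <= 1 &
      forall p, p \in s -> 0 < p.1 -> tau <= p.1].
    elim: s {c c0} => [|p s [tau [tau0 tau1 IH]]]; first by exists 1.
    exists (if 0 < p.1 then Num.min tau p.1 else tau); split.
    - by case: ifPn => // p0; rewrite lt_min tau0.
    - by case: ifPn => // p0; rewrite ge_min tau1.
    - move=> q; rewrite inE => /predU1P[->|qs] q0;
        first by rewrite q0 ge_min lexx orbT.
      by case: ifPn => _; rewrite ?ge_min IH.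
  have eta0 : 0 < (16 * c)^-1 by rewrite invr_gt0 mulr_gt0.
  have [t [t0 ttau vt dt]] := small_time eta0 tau0.
  have dt0 : 0 <= drift t by exact: sumr_ge0.
  (* The new time joins the list with the placeholder frequency 0, as the damping condition reads
     first components only. *)
  have [w [w1 w2 w3]] : exists w : R, [/\
      forall p, p \in (t, 0) :: s -> 0 < p.1 ->
          damp w (var Q B p.1%:E) <= (2 ^+ size s * 32)^-1,
      `|I lam [seq p.2 | p <- s] w| <= lam & `|I
          (- lam) [seq p.2 | p <- s] w| <= lam].
    near +oo_R => w; exists w; split.
    - near: w; apply: near_all => p _; have [p0|p0] := ltP 0 p.1;
        last exact: nearW.
      have v0 : 0 < var Q B p.1%:E by apply: var_gt0 => //; rewrite lte_fin.
      have e0 : 0 < (2 ^+ size s * 32)^-1 :> R by rewrite invr_gt0 mulr_gt0//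
          exprn_gt0.
      by apply: filterS (near_damp v0 e0) => w.
    - near: w; have /cvgrPdist_le/(_ _ lam0) := cvg_riesz PS
        (1 + 2 * lam ^+ 2) lam [seq p.2 | p <- s].
      by apply: filterS => w; rewrite sub0r normrN.
    - near: w; have /cvgrPdist_le/(_ _ lam0) := cvg_riesz PS
        (1 + 2 * lam ^+ 2) (- lam) [seq p.2 | p <- s].
      by apply: filterS => w; rewrite sub0r normrN.
  exists (t, w); split=> //=.
  - by rewrite t0/= (le_trans (ltW ttau)).
  - by move=> p ps p0; rewrite (lt_le_trans ttau)// taus.
  - move=> x xr; rewrite (le_trans (ler_norm_sum _ _ _))//.
    rewrite (@le_trans _ _ (\sum_(p <- s) (p.2 ^+ 2 + `|p.2| * r) *
        (16 * c)^-1))//.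
      apply: ler_sum => p _; apply: (le_trans (damp_cos_error _ t0 xr)).
      rewrite mulrDl lerD// ?ler_wpM2l ?sqr_ge0// -mulrA ler_wpM2l//
          mulrC ler_wpM2l//.
    rewrite -mulr_suml ler_pdivrMr ?mulr_gt0// /c; lra.
  - move=> p; rewrite mem_rcons inE => /predU1P[->|ps] p0; last by apply: w1;
      rewrite // inE ps orbT.
    by apply: (w1 (t, 0)); rewrite ?mem_head.
have [u Pu] := history_choice exP.
have u0 k : 0 < (u k).1 by have [/andP[]] := Pu k.
have um j k : (j < k)%N -> u j \in mkseq u k by move=> jk; apply/mapP;
    exists j; rewrite // mem_iota.
have w2 k : [seq p.2 | p <- mkseq u k] = mkseq (fun k =>
    (u k).2) k by rewrite /mkseq -map_comp.
exists (fun k => (u k).1), (fun k => (u k).2); split.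
- by move=> k; have [] := Pu k.
- by move=> j k jk; have [_ H _ _ _] := Pu k; apply: H; [exact: um|exact: u0].
- move=> k x xr; have [_ _ H _ _] := Pu k; have := H x xr;
    rewrite /err /mkseq big_map.
  by rewrite -[X in iota 0 X]subn0 -/(index_iota 0 k) big_mkord.
- move=> j k; rewrite leq_eqVlt => jk; have [_ _ _ H _] := Pu k.
  have := H (u j); rewrite size_mkseq; apply => //; rewrite mem_rcons inE.
  by case/predU1P: jk => [->|/um ->]; rewrite ?eqxx ?orbT.
- by move=> k; have [_ _ _ _] := Pu k; rewrite w2.
Unshelve. all: end_near. Qed.

End lacunary.

(** * Lower bound for the square function *)

Section large_square_function.
Variables (R : realType) (n : nat) (S : 'M[R]_n.+1).
Hypothesis PS : posdefmx S.

Lemma measurable_cube (r : R) : measurable [set x : 'cV[R]_n.+1 | cube r x].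
Proof.
rewrite (_ : [set x | cube r x] = \bigcap_(i in [set: 'I_n.+1]) ((fun x :
    'cV[R]_n.+1 => x i ord0) @^-1` `[- r, r])).
  apply: fin_bigcap_measurable => // i _.
  rewrite -[X in measurable X]setTI; exact: measurable_coord.
apply/seteqP; split=> x /= xr i; first by move=> _;
    rewrite /= in_itv/= -ler_norml.
by have := xr i I; rewrite /= in_itv/= -ler_norml.
Qed.

Lemma gauss_le1 (A : set 'cV[R]_n.+1) : measurable A -> (gauss S A <= 1)%E.
Proof. by move=> mA; rewrite -(gauss_setT PS); apply: le_measure;
    rewrite ?inE. Qed.

Lemma gauss_fin_num (A : set 'cV[R]_n.+1) : measurable A ->
    gauss S A \is a fin_num.
Proof.
move=> mA; rewrite ge0_fin_numE; last exact: measure_ge0.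
by rewrite (le_lt_trans (gauss_le1 mA))// ltry.
Qed.

(** The complements of the cubes of integer radius decrease to the empty set. *)
Lemma cube_large (e : R) : 0 < e -> exists2 r : R, 0 <= r &
  (gauss S (~` [set x : 'cV[R]_n.+1 | cube r x]) <= e%:E)%E.
Proof.
move=> e0; pose F (k : nat) := ~` [set x : 'cV[R]_n.+1 | cube k%:R x].
have mF k : measurable (F k) by apply: measurableC; exact: measurable_cube.
have F0 : \bigcap_k F k = set0.
  apply/seteqP; split=> // x Fx.
  have [k Hk] : exists k : nat, forall i, `|x i ord0| <= k%:R.
    pose M := \sum_i `|x i ord0|; exists (Num.truncn M).+1 => i.
    rewrite (@le_trans _ _ M)//; last by rewrite ltW// truncnS_gt.
    by rewrite /M (bigD1 i)//= lerDl sumr_ge0.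
  by apply: (Fx k I).
have cF : (gauss S \o F) @ \oo --> gauss S (\bigcap_k F k).
  apply: nonincreasing_cvg_mu => //.
  - by rewrite (le_lt_trans (gauss_le1 (mF 0%N)))// ltry.
  - by rewrite F0.
  - move=> j k jk; apply/subsetPset => x /= Fx; apply: contra_not Fx => xj i.
    by rewrite (le_trans (xj i))// ler_nat.
rewrite F0 measure0 in cF.
have [//|noF] := pselect (exists2 r :
    R, 0 <= r & (gauss S (~` [set x | cube r x]) <= e%:E)%E).
have : (e%:E <= limn (gauss S \o F))%E.
  apply: lime_ge; first by apply/cvg_ex; eexists; exact: cF.
  apply: nearW => k; rewrite leNgt; apply/negP => lt_e; apply: noF.
  by exists k%:R => //; exact: ltW.
by rewrite (cvg_lim _ cF)// lee_fin leNgt e0.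
Qed.

Definition cos2_sum (s : seq R) (x : 'cV[R]_n.+1) : R :=
  \sum_(w <- s) cos (w * last_coord x) ^+ 2.

Lemma cos2_sum_ge0 s x : 0 <= cos2_sum s x.
Proof. by apply: sumr_ge0 => w _; exact: sqr_ge0. Qed.

Lemma cos2_le1 (u : R) : cos u ^+ 2 <= 1.
Proof. by rewrite -(cos2Dsin2 u) lerDl sqr_ge0. Qed.

Lemma cos2_sum_le s x : cos2_sum s x <= (size s)%:R.
Proof.
rewrite /cos2_sum; elim: s => [|w s IH]; first by rewrite big_nil.
by rewrite big_cons /= -natr1 addrC lerD// cos2_le1.
Qed.

Lemma measurable_cos2_sum s : measurable_fun setT (cos2_sum s).
Proof.
apply: measurable_sum => w; apply: measurable_funX.
exact: measurable_cos_last.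
Qed.

(** By cos^2 u = (1 + cos 2u) / 2, where the Gaussian mean of the cosine is positive. *)
Lemma integral_cos2_sum s : (size s)%:R / 2 <= \int[gauss S]_x cos2_sum s x.
Proof.
have ic2 (w : R) : (gauss S).-integrable setT (EFin \o (fun x =>
    cos (w * last_coord x) ^+ 2)).
  apply: (@gauss_bounded_integrable _ _ _ PS _ 1).
    by apply: measurable_funX; exact: measurable_cos_last.
  by move=> x; rewrite ger0_norm ?sqr_ge0// cos2_le1.
have ic (w : R) : (gauss S).-integrable setT (EFin \o (fun x =>
    cos (w * last_coord x))).
  apply: (@gauss_bounded_integrable _ _ _ PS _ 1);
      first exact: measurable_cos_last.
  by move=> x; exact: norm_cos_le1.
rewrite /cos2_sum (Rintegral_sum s measurableT ic2).2.
rewrite -sum1_size natr_sum mulr_suml; apply: ler_sum => w _; rewrite mul1r.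
have i1 : (gauss S).-integrable setT (EFin \o (fun=> 1)).
  by apply: (@gauss_bounded_integrable _ _ _ PS _ 1) => // x; rewrite normr1.
have -> : \int[gauss S]_x (cos (w * last_coord x) ^+ 2) =
   \int[gauss S]_x (2^-1 * (1 + cos ((2 * w) * last_coord x))).
  apply: eq_Rintegral => x _.
  have -> : 2 * w * last_coord x = (w * last_coord x) *+ 2 by ring.
  by rewrite cos_mulr2n; field.
rewrite (RintegralZl _ measurableT (integrableD measurableT i1 (ic _))).
rewrite (RintegralD measurableT i1 (ic _)) gauss_cos// Rintegral_cst//.
rewrite (_ : fine (gauss S setT) = 1); last by rewrite gauss_setT.
by rewrite mul1r mulrDr mulr1 lerDl mulr_ge0// ltW// damp_gt0.
Qed.

(** An argument of Paley-Zygmund type: the sum is at most N everywhere and below N/4 on A outside E,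
    so its mean, at least N/2, is at most N times the measure of E, plus N/8, plus N/4. *)
Lemma gauss_large_set s (A : set 'cV[R]_n.+1) : (0 < size s)%N ->
    measurable A ->
  (gauss S (~` A) <= (1 / 8)%:E)%E ->
  let E := A `&` [set x | (size s)%:R / 4 <= cos2_sum s x] in
  measurable E /\ ((1 / 8)%:E <= gauss S E)%E.
Proof.
move=> s0 mA A8 E; set N := (size s)%:R : R.
have N0 : 0 < N by rewrite ltr0n.
have mE : measurable E.
  apply: measurableI => //.
  rewrite (_ : [set x | _] = cos2_sum s @^-1` `[N / 4, +oo[).
    rewrite -[X in measurable X]setTI; exact: measurable_cos2_sum.
  by apply/seteqP; split=> x /=; rewrite in_itv/= andbT.
split=> //.
have mAC : measurable (~` A) by exact: measurableC.
have i1 (C : set 'cV[R]_n.+1) : measurable C ->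
    (gauss S).-integrable setT (EFin \o (fun x => N * \1_C x)).
  move=> mC; apply: (@gauss_bounded_integrable _ _ _ PS _ N).
    by apply: measurable_funM => //; exact: measurable_indic.
  move=> x; rewrite ger0_norm ?mulr_ge0 ?(ltW N0)// indicE.
  by case: (_ \in _); rewrite ?mulr1 ?mulr0 ?(ltW N0).
have ic : (gauss S).-integrable setT (EFin \o (fun=> N / 4)).
  apply: (@gauss_bounded_integrable _ _ _ PS _ (N / 4)) => // x.
  by rewrite ger0_norm// divr_ge0// ltW.
have iZ : (gauss S).-integrable setT (EFin \o cos2_sum s).
  apply: (@gauss_bounded_integrable _ _ _ PS _ N);
      first exact: measurable_cos2_sum.
  by move=> x; rewrite ger0_norm ?cos2_sum_ge0 ?cos2_sum_le.
have Rind (C : set 'cV[R]_n.+1) : measurable C ->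
    \int[gauss S]_x (N * \1_C x) = N * fine (gauss S C).
  move=> mC; have := i1 C mC => iC.
  rewrite RintegralZl//; last first.
    apply: (@gauss_bounded_integrable _ _ _ PS _ 1);
        first exact: measurable_indic.
    by move=> x; rewrite indicE; case: (_ \in _); rewrite ?normr1 ?normr0.
  by rewrite /Rintegral integral_indic// setIT.
have iD := integrableD measurableT (i1 _ mE) (i1 _ mAC).
have : \int[gauss S]_x cos2_sum s x <=
    \int[gauss S]_x (N * \1_E x + N * \1_(~` A) x + N / 4).
  apply: le_Rintegral => //; first exact: (integrableD measurableT iD ic).
  move=> x _; rewrite !indicE; have := cos2_sum_le s x; rewrite -/N => Zle.
  have [xA|xA] := boolP (x \in ~` A).
    by case: (x \in E); rewrite ?mulr1 ?mulr0; lra.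
  have [xE|xE] := boolP (x \in E); first by rewrite mulr1 mulr0; lra.
  rewrite !mulr0 !add0r leNgt; apply/negP => Zgt; move/negP: xE; apply.
  rewrite inE; split; last exact: ltW.
  by move: xA; rewrite notin_setE /= => /contrapT.
rewrite (RintegralD measurableT iD ic) (RintegralD measurableT (i1 _ mE)
    (i1 _ mAC)).
rewrite !Rind// Rintegral_cst// (_ : fine (gauss S setT) = 1);
    last by rewrite gauss_setT.
have := integral_cos2_sum s; rewrite -/N => h1 h2.
have h3 : fine (gauss S (~` A)) <= 1 / 8.
  by rewrite -lee_fin fineK// gauss_fin_num.
rewrite -[leRHS]fineK ?gauss_fin_num// lee_fin.
have h4 : N * fine (gauss S (~` A)) <= N * (1 / 8) by rewrite ler_wpM2l// ltW.
rewrite -(ler_pM2l N0).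
have key (z e a : R) : N / 2 <= z -> z <= N * e + N * a + N / 4 * 1 ->
    N * a <= N * (1 / 8) -> N * (1 / 8) <= N * e.
  by clear; lra.
exact: key h1 h2 h4.
Qed.

End large_square_function.

(** * Exponential moments *)

Section exponential_moments.
Variables (R : realType) (n : nat) (S : 'M[R]_n.+1).
Hypothesis PS : posdefmx S.

(** From exp y <= 1 / (1 - y), as (1 - y) (1 + y + 2 y^2) = 1 + y^2 (1 - 2 y). *)
Lemma expR_le_quadratic (y : R) : y <= 1 / 2 -> expR y <= 1 + y + 2 * y ^+ 2.
Proof.
move=> y12; have y1 : 0 < 1 - y by lra.
have : expR y <= (1 - y)^-1.
  rewrite -[expR y]invrK -expRN lef_pV2 ?posrE ?expR_gt0//.
  exact: expR_ge1Dx.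
move=> /le_trans; apply; rewrite -[leLHS]mul1r ler_pdivrMr//.
have : 0 <= y ^+ 2 * (1 - 2 * y) by rewrite mulr_ge0 ?sqr_ge0//; lra.
nra.
Qed.

Lemma expR_cos_sum_le_riesz (l : R) s (x : 'cV[R]_n.+1) : `|l| <= 1 / 2 ->
  expR (l * cos_sum s x) <= riesz (1 + 2 * l ^+ 2) l s x.
Proof.
move=> l12; rewrite /cos_sum /riesz; elim: s => [|w s IH].
  by rewrite !big_nil mulr0 expR0.
rewrite !big_cons mulrDr expRD ler_pM ?expR_ge0//.
set c := cos _; have c1 : `|c| <= 1 by exact: norm_cos_le1.
have lc : l * c <= 1 / 2.
  rewrite (le_trans (ler_norm _))// normrM (le_trans _ l12)//.
  by rewrite -[leRHS]mulr1 ler_wpM2l.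
rewrite (le_trans (expR_le_quadratic lc))//.
have : l ^+ 2 * c ^+ 2 <= l ^+ 2.
  by rewrite -[leRHS]mulr1 ler_wpM2l ?sqr_ge0// cos2_le1.
rewrite exprMn; lra.
Qed.

Lemma measurable_cos_sum s : measurable_fun setT (@cos_sum R n s).
Proof. by apply: measurable_sum => w; exact: measurable_cos_last. Qed.

Lemma cos_sum_bounded s (x : 'cV[R]_n.+1) : `|cos_sum s x| <= (size s)%:R.
Proof.
rewrite /cos_sum (le_trans (ler_norm_sum _ _ _))//.
by rewrite -sum1_size natr_sum ler_sum// => w _; exact: norm_cos_le1.
Qed.

Lemma integrable_expR_cos_sum (l : R) s :
  (gauss S).-integrable setT (EFin \o (fun x => expR (l * cos_sum s x))).
Proof.
apply: (@gauss_bounded_integrable _ _ _ PS _ (expR (`|l| * (size s)%:R))).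
  by apply: measurableT_comp => //; apply: measurable_funM => //;
      exact: measurable_cos_sum.
move=> x; rewrite ger0_norm ?expR_ge0// ler_expR (le_trans (ler_norm _))//
    normrM.
by rewrite ler_wpM2l// cos_sum_bounded.
Qed.

Lemma integrable_riesz a l s :
    (gauss S).-integrable setT (EFin \o @riesz R n a l s).
Proof.
apply: (@gauss_bounded_integrable _ _ _ PS _ ((`|a| + `|l|) ^+ size s)).
  exact: measurable_riesz.
by move=> x; exact: riesz_bounded.
Qed.

(** A new factor multiplies the integral by a = 1 + 2 lam^2 up to an error lam^2. Carrying J k + 1
    through the induction absorbs the error, because a >= 1 + lam^2. *)
Lemma integral_riesz_le (lam l : R) (w : nat -> R) : 0 <= lam -> `|l| <= lam ->
  (forall k, `|\int[gauss S]_x (riesz (1 + 2 * lam ^+ 2) l (mkseq w k) x *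
     cos (w k * last_coord x))| <= lam) ->
  forall k, \int[gauss S]_x riesz (1 + 2 * lam ^+ 2) l (mkseq w k) x
    <= 2 * (1 + 2 * lam ^+ 2) ^+ k.
Proof.
move=> lam0 llam small; set a := 1 + 2 * lam ^+ 2.
have a1 : 1 <= a by rewrite /a lerDl mulr_ge0 ?sqr_ge0.
pose J k := \int[gauss S]_x riesz a l (mkseq w k) x.
suff H k : J k + 1 <= 2 * a ^+ k by move=> k; apply: le_trans (H k);
    rewrite lerDl.
elim: k => [|k IH].
  rewrite /J (_ : riesz _ _ _ = cst 1); last by apply/funext => x;
      rewrite /riesz big_nil.
  rewrite Rintegral_cst// (_ : fine (gauss S setT) = 1);
      last by rewrite gauss_setT.
  by rewrite expr0 !mulr1.
have -> : J k.+1 = a * J k + l * \int[gauss S]_x (riesz a l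
    (mkseq w k) x * cos (w k * last_coord x)).
  have i1 := integrable_riesz a l (mkseq w k).
  have i2 := integrable_riesz_cos PS a l (mkseq w k) (w k).
  rewrite -(RintegralZl _ measurableT i1) -(RintegralZl _ measurableT i2).
  rewrite -(RintegralD measurableT (integrableZl measurableT a i1)
      (integrableZl measurableT l i2)).
  apply: eq_Rintegral => x _; rewrite mkseqS /riesz -cats1 big_cat big_seq1 /=.
  by rewrite mulrDr mulrC [_ * (l * _)]mulrCA.
have lI : l * \int[gauss S]_x (riesz a l (mkseq w k) x * cos
    (w k * last_coord x)) <= lam * lam.
  by rewrite (le_trans (ler_norm _))// normrM ler_pM.
rewrite exprS mulrCA.
have ak : a * (J k + 1) <= a * (2 * a ^+ k) by rewrite ler_wpM2l//
    (le_trans _ a1).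
have key (j I b m : R) : 0 <= m -> I <= m -> (1 + 2 * m) * (j + 1) <= b ->
    (1 + 2 * m) * j + I + 1 <= b by clear; lra.
by apply: (key _ _ _ (lam ^+ 2)); rewrite ?sqr_ge0 ?expr2.
Qed.

(** For y >= 1 the power is at most the next integer power, hence at most a factorial times exp y;
    for y < 1 it is at most 1. *)
Lemma powR_le_expR (p : R) : 0 <= p -> exists2 K : R, 0 < K &
  forall y, 0 <= y -> y `^ p <= K * expR y.
Proof.
move=> p0; pose M := Num.truncn p; exists (1 + (M.+1)`!%:R);
    first by rewrite ltr_wpDr.
move=> y y0; have e1 : 1 <= expR y by rewrite -expR0 ler_expR.
have [y1|y1] := leP 1 y; last first.
  rewrite mulrDl mul1r (@le_trans _ _ 1)//;
      last by rewrite ler_wpDr// mulr_ge0// expR_ge0.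
  have := @ge0_ler_powR R p p0 y 1; rewrite powR1 !nnegrE y0 ler01 (ltW y1);
      exact.
rewrite (@le_trans _ _ (y `^ M.+1%:R))//.
  by rewrite ler_powR// ltW// truncnS_gt.
rewrite powR_mulrn// mulrDl mul1r ler_wpDl ?expR_ge0//
    -ler_pdivrMl ?ltr0n ?fact_gt0//.
by rewrite mulrC (le_trans _ (expR_ge1Dxn M y0))// lerDr.
Qed.

(** The bound on y^p is applied to y = lam |f|, with exp (lam |f|) at most exp (lam f) + exp (- lam
    f). The constant depends on p alone, which leaves lam free to vary with N. *)
Lemma Lnorm_cos_sum_le (p : R) : 1 <= p -> exists2 K : R, 0 < K &
  forall (lam M : R) s, 0 < lam ->
    \int[gauss S]_x expR (lam * cos_sum s x) <= M ->
    \int[gauss S]_x expR (- lam * cos_sum s x) <= M ->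
    (Lnorm (gauss S) p%:E (EFin \o @cos_sum R n s) <= (lam^-1 *
        (K * M) `^ p^-1)%:E)%E.
Proof.
move=> p1; have p0 : 0 < p by exact: lt_le_trans p1.
have [K K0 HK] := powR_le_expR (ltW p0).
exists (2 * K); first exact: mulr_gt0.
move=> lam M s lam0 M1 M2.
have i1 := integrable_expR_cos_sum lam s;
    have i2 := integrable_expR_cos_sum (- lam) s.
have iD := integrableD measurableT i1 i2.
pose c := (lam `^ p)^-1 * K.
have lp0 : 0 < lam `^ p by exact: powR_gt0.
have c0 : 0 <= c by rewrite mulr_ge0 ?invr_ge0// ltW.
have ic := integrableZl measurableT c iD.
rewrite unlock.
have M0 : 0 <= M by apply: le_trans M1; apply: Rintegral_ge0 => // x _;
    exact: expR_ge0.
(* Each of the two exponentials contributes M, hence the factor 2 in the constant. *)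
have -> : (lam^-1 * (2 * K * M) `^ p^-1)%:E = ((c * (M + M))%:E `^ p^-1)%E.
  rewrite poweR_EFin /c; congr EFin.
  rewrite (_ : _ * (M + M) = (lam `^ p)^-1 * (2 * K * M)); last by ring.
  rewrite [RHS]powRM ?invr_ge0 ?(ltW lp0)//; last by rewrite !mulr_ge0// ltW.
  by rewrite -powRN -powRrM mulNr mulfV ?gt_eqF// powR_inv1// ltW.
apply: le_poweR; first by rewrite invr_ge0 ltW.
  by apply: integral_ge0 => x _; exact: poweR_ge0.
apply: (@le_trans _ _ (\int[gauss S]_x (c * (expR (lam * cos_sum s x) + expR
    (- lam * cos_sum s x)))%:E)%E).
  apply: le_nnintegral => x; first exact: poweR_ge0.
  rewrite [`|_|%E]abse_EFin poweR_EFin lee_fin /c -mulrA -ler_pdivrMl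
      ?invr_gt0// invrK.
  rewrite -powRM// ?(ltW lam0)// (le_trans (HK _ _)) ?mulr_ge0// ?(ltW lam0)//.
  rewrite ler_wpM2l// ?(ltW K0)//.
  have [f0|f0] := leP 0 (cos_sum s x).
    by rewrite ger0_norm// lerDl expR_ge0.
  by rewrite ltr0_norm// mulrN -mulNr lerDr expR_ge0.
rewrite -[leLHS]fineK; last exact: integrable_fin_num ic.
rewrite lee_fin -/(Rintegral _ _ _).
rewrite (RintegralZl _ measurableT iD) (RintegralD measurableT i1 i2).
by rewrite ler_wpM2l// lerD.
Qed.

End exponential_moments.

(** * Failure of the oscillation inequalities *)

Section extremal_family.
Variables (R : realType) (n : nat) (Q B : 'M[R]_n.+1).
Hypotheses (PQ : posdefmx Q) (HB : hurwitzmx B).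

Lemma geometric_tail (N : nat) :
    \sum_(0 <= k < N) (2 ^+ k * 32)^-1 <= 1 / 16 - (2 ^+ N * 16)^-1 :> R.
Proof.
elim: N => [|N IH]; first by rewrite big_geq// expr0 mul1r; lra.
rewrite big_nat_recr//=; apply: (le_trans (lerD IH (lexx _))).
rewrite exprS !invfM; set q := (2 ^+ N)^-1.
by rewrite le_eqVlt; apply/orP; left; apply/eqP; field.
Qed.

(** This reduces the power rho to the square function. If |c| <= 1/4 the left side is negative;
    otherwise |c| - 1/4 lies between 0 and 1, so its power rho is at least its square, which exceeds
    the left side by (|c| - 1/2)^2 / 2. *)
Lemma powR_ge_square (rho c d : R) : 1 <= rho < 2 -> `|c| <= 1 ->
    `|c| - 1 / 4 <= `|d| ->
  c ^+ 2 / 2 - 1 / 16 <= `|d| `^ rho.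
Proof.
move=> /andP[rho1 rho2] c1 cd.
have r0 : 0 <= rho by exact: le_trans rho1.
have c2 : c ^+ 2 = `|c| ^+ 2 by rewrite real_normK ?num_real.
have [b0|b0] := leP `|c| (1 / 4).
  rewrite (@le_trans _ _ 0) ?powR_ge0// c2.
  by have := normr_ge0 c; nra.
apply: (@le_trans _ _ ((`|c| - 1 / 4) `^ rho)); last first.
  by apply: ge0_ler_powR => //; rewrite nnegrE; lra.
apply: (@le_trans _ _ ((`|c| - 1 / 4) `^ 2%:R)); last first.
  by apply: ger_powR; [apply/andP; split; lra|exact: ltW].
rewrite powR_mulrn; last by lra.
by rewrite c2; have := sqr_ge0 (`|c| - 1 / 2); nra.
Qed.

(** The sum is cut at index i: frequencies below i are nearly unchanged at time t_i, those from i on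
    are damped geometrically, and each part costs at most 1/16. *)
Lemma OU_partial_sum (t w : nat -> R) (r : R) (x : 'cV[R]_n.+1) (N i : nat) :
  (forall k, 0 < t k) -> cube r x ->
  (forall k x, cube r x ->
      `|\sum_(j < k) (damp (w j) (var Q B (t k)%:E) *
          cos (w j * last_coord (expmx (t k *:
              B) *m x)) - cos (w j * last_coord x))| <= 1 / 16) ->
  (forall j k, (j <= k)%N -> damp (w k) (var Q B (t j)%:E) <=
      (2 ^+ k * 32)^-1) ->
  (i <= N)%N ->
  `|OU Q B (t i) (cos_sum (mkseq w N)) x - \sum_(k < i) cos
      (w k * last_coord x)| <= 1 / 8.
Proof.
move=> t0 xr low high iN; rewrite OU_cos_sum// /mkseq big_map.
rewrite -[X in iota 0 X]subn0 -/(index_iota 0 N).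
pose F (k : nat) : R := damp (w k) (var Q B (t i)%:E) *
  cos (w k * last_coord (expmx (t i *: B) *m x)).
rewrite -(big_mkord xpredT (fun k => cos (w k * last_coord x))).
rewrite (big_cat_nat _ iN)//= addrAC -sumrB.
have H1 := low i x xr; rewrite -(big_mkord xpredT
  (fun j => damp (w j) (var Q B (t i)%:E) * cos (w j * last_coord (expmx
      (t i *: B) *m x)) -
   cos (w j * last_coord x))) in H1.
rewrite (le_trans (ler_normD _ _))//.
suff H2 : `|\sum_(i <= k < N) F k| <= 1 / 16.
  apply: (le_trans (lerD H1 H2)); lra.
rewrite (le_trans (ler_norm_sum _ _ _))//.
apply: (@le_trans _ _ (\sum_(i <= k < N) (2 ^+ k * 32)^-1)).
  rewrite big_nat_cond [leRHS]big_nat_cond;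
      apply: ler_sum => k /andP[/andP[ik _] _].
  rewrite /F normrM ger0_norm ?(ltW (damp_gt0 _ _))// -[leRHS]mulr1.
  by rewrite ler_pM ?(ltW (damp_gt0 _ _)) ?norm_cos_le1 ?high.
apply: (@le_trans _ _ (\sum_(0 <= k < N) (2 ^+ k * 32)^-1)).
  rewrite [leRHS](big_cat_nat _ iN)//= lerDr; apply: sumr_ge0 => k _.
  by rewrite invr_ge0 mulr_ge0// exprn_ge0.
apply: (le_trans (geometric_tail N));
    rewrite gerBl invr_ge0 mulr_ge0// exprn_ge0//.
Qed.

(** Each supremum is tested at the other endpoint, t (i-1). The increment there is a single c k up
    to 1/8 + 1/8, the slack of [powR_ge_square], and the sum is at least N/8 - N/16. *)
Lemma oscillation_ge (rho : R) N (t : nat -> R) (u : R -> R) (c : nat -> R) :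
  1 <= rho < 2 -> (forall k, `|c k| <= 1) ->
  (forall i, (i <= N)%N -> `|u (t i) - \sum_(k < i) c k| <= 1 / 8) ->
  (N%:R / 4 <= \sum_(k < N) c k ^+ 2) ->
  (((N%:R / 16) `^ rho^-1)%:E <= oscillation rho N t u)%E.
Proof.
move=> rho12 c1 uc cN; rewrite /oscillation -poweR_EFin.
have rho0 : 0 <= rho^-1 by rewrite invr_ge0;
    case/andP: rho12 => /(le_trans ler01).
apply: le_poweR => //.
apply: (@le_trans _ _ (\sum_(k < N) c k ^+ 2 / 2 - N%:R / 16)%:E).
  by rewrite lee_fin -mulr_suml; lra.
have -> : \sum_(k < N) c k ^+ 2 / 2 - N%:R / 16 = \sum_(0 <= k < N)
    (c k ^+ 2 / 2 - 1 / 16).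
  rewrite sumrB big_mkord; congr (_ - _).
  by rewrite sumr_const_nat subn0 -(mulr_natl (1 / 16)) mul1r.
rewrite -sumEFin big_add1 /= big_nat_cond [leRHS]big_nat_cond.
apply: lee_sum => k /andP[/andP[_ kN] _].
apply: ereal_sup_ge; exists ((`|u (t k) - u (t k.+1)| `^ rho)%:E).
  by exists (t k) => //=; rewrite ge_min lexx /= le_max lexx.
rewrite lee_fin; apply: powR_ge_square => //.
have h1 := uc k (ltnW kN); have h2 := uc k.+1 kN.
rewrite big_ord_recr/= in h2; move: h1 h2; set A := \sum_(_ < k) _ => h1 h2.
have : `|c k| <= `|u (t k) - u (t k.+1)| + (`|u (t k) - A| + `|u (t k.+1) -
    (A + c k)|).
  have E : c k = - (u (t k) - u (t k.+1)) + ((u (t k) - A) - (u (t k.+1) -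
      (A + c k))) by ring.
  rewrite [leLHS](congr1 Num.norm E) (le_trans (ler_normD _ _))//
      normrN lerD2l (le_trans (ler_normB _ _))//.
move=> H; rewrite lerBlDr (le_trans H)// lerD2l (le_trans (lerD h1 h2))//.
by rewrite -mulrDl ler_pdivlMr//; lra.
Qed.

Lemma extremal_family (rho : R) (N : nat) : 1 <= rho < 2 -> (4 <= N)%N ->
  exists (s : seq R) (t : nat -> R) (E : set 'cV[R]_n.+1),
  [/\ size s = N, strict_decr N t, seq_in [set s | 0 < s <= 1] N t,
      measurable E /\ ((1 / 8)%:E <= gauss_infty Q B E)%E &
      (forall x, E x ->
        (((N%:R / 16) `^ rho^-1)%:E <= OU_oscillation Q B rho N t
            (cos_sum s) x)%E) /\
      forall l : R, `|l| = (Num.sqrt N%:R)^-1 ->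
        \int[gauss_infty Q B]_x expR (l * cos_sum s x) <= 2 * expR 2].
Proof.
move=> rho12 N4; have PS : posdefmx (covmx Q B +oo) by exact: covmx_posdef.
have N0 : 0 < N%:R :> R by rewrite ltr0n (leq_trans _ N4).
(* This scale keeps (1 + 2 lam^2)^N below exp 2, while its inverse is the claimed size of the norms.
   The assumption [4 <= N] yields lam <= 1/2, the range of the quadratic bound for the
   exponential. *)
pose lam : R := (Num.sqrt N%:R)^-1.
have lam0 : 0 < lam by rewrite invr_gt0 sqrtr_gt0.
have lam2 : lam ^+ 2 = N%:R^-1 by rewrite /lam exprVn sqr_sqrtr// ltW.
have lam12 : lam <= 1 / 2.
  rewrite -ler_sqr ?nnegrE ?(ltW lam0)//.
  rewrite lam2 (_ : (1 / 2) ^+ 2 = 4^-1); last by field.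
  by rewrite lef_pV2 ?posrE// ler_nat.
have e8 : 0 < 1 / 8 :> R by lra.
have [r r0 rE] := cube_large PS e8.
have [t [w [t01 tdec low high rz]]] := lacunary_sequences PQ HB r0 lam0.
have t0 k : 0 < t k by case/andP: (t01 k).
have sN : (0 < size (mkseq w N))%N by rewrite size_mkseq (leq_trans _ N4).
have [mE E8] := gauss_large_set PS sN (@measurable_cube _ _ r) rE.
exists (mkseq w N), t, ([set x | cube r x] `&`
  [set x | (size (mkseq w N))%:R / 4 <= cos2_sum (mkseq w N) x]); split.
- exact: size_mkseq.
- by move=> i j /andP[ij _]; exact: tdec.
- by move=> i _; exact: t01.
- by [].
split=> [x [xr /=]|l ll].
  have -> : cos2_sum (mkseq w N) x = \sum_(k < N) cos (w k * last_coord x) ^+ 2.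
    by rewrite /cos2_sum /mkseq big_map -[X in iota 0 X]subn0 -/(index_iota 0
        N) big_mkord.
  rewrite size_mkseq => xN.
  apply: (oscillation_ge (c := fun k => cos (w k * last_coord x))) => //.
    by move=> k; exact: norm_cos_le1.
  by move=> i iN; exact: (OU_partial_sum t0 xr low high iN).
have l2 : l ^+ 2 = lam ^+ 2 by rewrite -(real_normK (num_real l)) ll.
have i1 := integrable_expR_cos_sum PS l (mkseq w N).
have i2 := integrable_riesz PS (1 + 2 * lam ^+ 2) l (mkseq w N).
apply: (@le_trans _ _ (\int[gauss (covmx Q B +oo)]_x riesz
    (1 + 2 * lam ^+ 2) l (mkseq w N) x)).
  apply: le_Rintegral => // x _; rewrite -l2; apply: expR_cos_sum_le_riesz.
  by rewrite ll.
have small k : `|\int[gauss (covmx Q B +oo)]_x (riesz (1 + 2 * lam ^+ 2) l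
    (mkseq w k) x *
     cos (w k * last_coord x))| <= lam.
  have [rz1 rz2] := rz k; move: ll; rewrite -/lam => ll.
  have [l0|l0] := leP 0 l; first by rewrite -(ger0_norm l0) ll.
  by rewrite -[l]opprK -(ltr0_norm l0) ll.
apply: (le_trans (integral_riesz_le PS (ltW lam0) _ small N));
    first by rewrite ll.
rewrite ler_pM2l//.
have -> : expR 2 = expR (2 * lam ^+ 2) ^+ N.
  by rewrite -expRM_natl lam2 mulrCA mulfV ?mulr1// gt_eqF.
rewrite lerXn2r ?nnegrE ?expR_ge0 ?addr_ge0 ?mulr_ge0 ?(ltW lam0)//.
exact: expR_ge1Dx.
Qed.

End extremal_family.

(** * Comparison of the rates N^(1/rho) and N^(1/2) *)

Section failure.
Variables (R : realType) (n : nat) (Q B : 'M[R]_n.+1).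
Hypotheses (PQ : posdefmx Q) (HB : hurwitzmx B).
Notation mu := (gauss_infty Q B).

Let PS : posdefmx (covmx Q B +oo). Proof. exact: covmx_posdef. Qed.

(** The surplus N^d, with d = 1/rho - 1/2 positive because rho < 2, absorbs every constant. *)
Lemma powR_sqrt_growth (rho A c : R) : 1 <= rho < 2 -> 0 < c ->
  \forall N \near \oo, A * Num.sqrt N%:R <= c * (N%:R / 16) `^ rho^-1.
Proof.
move=> /andP[rho1 rho2] c0; pose d := rho^-1 - 2^-1.
have rho0 : 0 < rho by exact: lt_le_trans rho1.
have d0 : 0 < d by rewrite subr_gt0 ltf_pV2 ?posrE.
pose M := `|A| * 16 `^ rho^-1 / c.
have M0 : 0 <= M by rewrite divr_ge0 ?mulr_ge0 ?powR_ge0// ltW.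
near=> N.
have N1 : (0 < N)%N by near: N; exact: nbhs_infty_gt.
have N0 : 0 < N%:R :> R by rewrite ltr0n.
have MN : M `^ d^-1 <= N%:R by near: N; exact: nbhs_infty_ger.
have {}MN : M <= N%:R `^ d.
  apply: (@le_trans _ _ ((M `^ d^-1) `^ d)).
    by rewrite -powRrM mulVf ?gt_eqF// powRr1.
  by apply: ge0_ler_powR; rewrite ?nnegrE ?powR_ge0// ?(ltW d0)// ltW.
have -> : (N%:R / 16) `^ rho^-1 = Num.sqrt N%:R * (N%:R `^ d / 16 `^ rho^-1).
  rewrite powRM ?invr_ge0 ?ltW// -powR12_sqrt ?ltW// mulrA -powRD;
      last by rewrite (gt_eqF N0) implybT.
  rewrite /d addrC subrK; congr (_ * _).
  by rewrite -(powR_inv1 (ler0n _ 16)) -powRrM mulN1r powRN.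
have N16 : 0 < 16 `^ rho^-1 :> R by rewrite powR_gt0.
rewrite mulrCA [leLHS]mulrC ler_wpM2l ?sqrtr_ge0// mulrA ler_pdivlMr//.
rewrite (@le_trans _ _ (`|A| * 16 `^ rho^-1))//.
  by rewrite ler_wpM2r ?ler_norm// ltW.
by rewrite -ler_pdivrMl// mulrC.
Unshelve. all: end_near. Qed.

(** The mean of the sum is a nonempty sum of damping factors, all positive. *)
Lemma cos_sum_Lnorm_neq0 (p : R) s : 0 < p -> (0 < size s)%N ->
  Lnorm mu p%:E (EFin \o @cos_sum R n s) != 0%E.
Proof.
move=> p0 s0; apply/eqP => L0.
have mf : measurable_fun setT (EFin \o @cos_sum R n s).
  by apply/measurable_EFinP; exact: measurable_cos_sum.
have f0 : ae_eq mu setT (EFin \o @cos_sum R n s) (cst 0%E).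
  have p0' : (0 < p%:E)%E by rewrite lte_fin.
  by apply: filterS (Lnorm_eq0_eq0 mf p0' L0) => x /= ->.
have : \int[mu]_x cos_sum s x = 0.
  by rewrite /Rintegral (ae_eq_integral (cst 0%E))// integral0.
rewrite (Rintegral_sum s measurableT (fun w => _)).2; last first.
  move=> w; apply: (@gauss_bounded_integrable _ _ _ PS _ 1);
      first exact: measurable_cos_last.
  by move=> x; exact: norm_cos_le1.
case: s s0 {L0 mf f0} => // w s _; rewrite big_cons gauss_cos// => /eqP;
    apply/negP.
rewrite gt_eqF// ltr_pwDl ?damp_gt0//; apply: sumr_ge0 => v _.
by rewrite gauss_cos// ltW// damp_gt0.
Qed.

Lemma cos_sum_Lfun (p : R) s : 1 <= p -> @cos_sum R n s \in Lfun mu p%:E.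
Proof.
move=> p1; have [K K0 HK] := Lnorm_cos_sum_le PS p1.
rewrite inE; apply/andP; split; rewrite inE.
  exact: measurable_cos_sum.
rewrite /finite_norm /=.
apply: le_lt_trans (HK 1 (Num.max (\int[mu]_x expR (1 * cos_sum s x))
  (\int[mu]_x expR (- 1 * cos_sum s x))) s ltr01 _ _) _;
      rewrite ?le_max ?lexx ?orbT//.
exact: ltry.
Qed.

(** Functions and times are fixed before p, so the same family serves the given exponent and, with p
    = 1, the weak type inequality. *)
Lemma oscillation_family (rho : R) : 1 <= rho < 2 ->
  exists (f : nat -> 'cV[R]_n.+1 -> R) (t : nat -> nat -> R),
  (forall p, 1 <= p -> exists2 K : R, 0 < K & forall N, (4 <= N)%N ->
     (Lnorm mu p%:E (EFin \o f N) <= (K * Num.sqrt N%:R)%:E)%E) /\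
  forall N, (4 <= N)%N ->
  [/\ strict_decr N (t N), seq_in [set s | 0 < s <= 1] N (t N),
     (forall p, 1 <= p -> f N \in Lfun mu p%:E /\ Lnorm mu p%:E
         (EFin \o f N) != 0%E) &
     exists E : set 'cV[R]_n.+1, [/\ measurable E, ((1 / 8)%:E <= mu E)%E &
      forall x, E x -> (((N%:R / 16) `^ rho^-1)%:E <= OU_oscillation Q B rho N
          (t N) (f N) x)%E]].
Proof.
move=> rho12.
have /choice[s] : forall N, exists s, (4 <= N)%N -> exists (t : nat ->
    R) (E : set 'cV[R]_n.+1),
  [/\ size s = N, strict_decr N t, seq_in [set s | 0 < s <= 1] N t,
      measurable E /\ ((1 / 8)%:E <= mu E)%E &
      (forall x, E x ->
        (((N%:R / 16) `^ rho^-1)%:E <= OU_oscillation Q B rho N t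
            (cos_sum s) x)%E) /\
      forall l : R, `|l| = (Num.sqrt N%:R)^-1 ->
        \int[mu]_x expR (l * cos_sum s x) <= 2 * expR 2].
  move=> N; have [N4|N4] := leqP 4 N; last by exists [::].
  by have [s Hs] := extremal_family PQ HB rho12 N4; exists s.
move=> Hs.
have /choice[t Ht] : forall N, exists t : nat -> R, (4 <= N)%N ->
    exists (E : set 'cV[R]_n.+1),
  [/\ size (s N) = N, strict_decr N t, seq_in [set s | 0 < s <= 1] N t,
      measurable E /\ ((1 / 8)%:E <= mu E)%E &
      (forall x, E x ->
        (((N%:R / 16) `^ rho^-1)%:E <= OU_oscillation Q B rho N t (cos_sum
            (s N)) x)%E) /\
      forall l : R, `|l| = (Num.sqrt N%:R)^-1 ->
        \int[mu]_x expR (l * cos_sum (s N) x) <= 2 * expR 2].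
  move=> N; have [N4|N4] := leqP 4 N; last by exists (fun=> 0).
  by have [t ?] := Hs N N4; exists t.
exists (fun N => cos_sum (s N)), t; split=> [p p1|N N4].
  have [K K0 HK] := Lnorm_cos_sum_le PS p1.
  exists ((K * (2 * expR 2)) `^ p^-1);
      first by rewrite powR_gt0// !mulr_gt0 ?expR_gt0.
  move=> N N4; have [_ [_ _ _ _ [_ small]]] := Ht N N4.
  have N0 : 0 < Num.sqrt N%:R :> R by rewrite sqrtr_gt0 ltr0n (leq_trans _ N4).
  rewrite mulrC -[X in X * _]invrK; apply: HK; rewrite ?invr_gt0//;
      apply: small.
    by rewrite ger0_norm// invr_ge0 ltW.
  by rewrite normrN ger0_norm// invr_ge0 ltW.
have [E [sN td tin [mE E8] [EO _]]] := Ht N N4; split=> //; last by exists E.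
move=> p p1; split; first exact: cos_sum_Lfun.
by apply: cos_sum_Lnorm_neq0;
    rewrite ?(lt_le_trans ltr01 p1)// sN (leq_trans _ N4).
Qed.

(** The superlevel set is not known to be measurable, so monotonicity is obtained by writing its
    measure as the integral of a nonnegative density. *)
Lemma weak_norm_ge (g : 'cV[R]_n.+1 -> \bar R) (E : set 'cV[R]_n.+1) (a : R) :
  0 < a -> measurable E -> (forall x, E x -> (a%:E < `|g x|)%E) ->
  (a%:E * mu E <= weak_norm mu g)%E.
Proof.
move=> a0 mE Eg; apply: (@le_trans _ _ (a%:E * mu [set x | a%:E < `|g x|])%E).
  apply: lee_wpmul2l; first by rewrite lee_fin ltW.
  have muE V : (mu V = \int[lebesgue_vec R n.+1]_(x in V) (gauss_pdf
      (covmx Q B +oo) x)%:E)%E.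
    by [].
  rewrite !muE integral_mkcond [leRHS]integral_mkcond.
  apply: le_nnintegral => x; rewrite !patchE.
    by case: ifP => // _; rewrite lee_fin gauss_pdf_ge0.
  case: ifPn => [xE|_].
    by rewrite mem_set//; apply: Eg; exact: set_mem.
  by case: ifPn => // _; rewrite lee_fin gauss_pdf_ge0.
by apply: ereal_sup_ubound; exists a.
Qed.

End failure.

Unset Implicit Arguments.
Set Strict Implicit.
Local Open Scope ereal_scope.

Theorem proposition7p1 (R : realType) (n : nat) (Q B : 'M[R]_n) (rho p : R)
    (n_gt0 : (0 < n)%N) (Q_posdef : posdefmx Q) (B_hurwitz : hurwitzmx B)
    (rho_bounds : (1 <= rho < 2)%R) (p_ge1 : (1 <= p)%R) :
  [/\ ~ (exists C : R,
        forall (f : 'cV[R]_n -> R) (N : nat) (t : nat -> R),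
          f \in Lfun (gauss_infty Q B) p%:E ->
          (1 <= N)%N -> strict_incr N t \/ strict_decr N t ->
          seq_in [set s : R | (0 < s)%R] N t ->
          Lnorm (gauss_infty Q B) p%:E (OU_oscillation Q B rho N t f)
            <= C%:E * Lnorm (gauss_infty Q B) p%:E (EFin \o f)),
      exists (N0 : nat) (f : nat -> 'cV[R]_n -> R) (t : nat -> nat -> R),
        (forall N : nat, (N0 <= N)%N ->
          [/\ f N \in Lfun (gauss_infty Q B) p%:E,
              Lnorm (gauss_infty Q B) p%:E (EFin \o f N) != 0,
              strict_decr N (t N) &
              seq_in [set s : R | (0 < s <= 1)%R] N (t N)]) /\
        (fun N : nat =>
           Lnorm (gauss_infty Q B) p%:E (OU_oscillation Q B rho N (t N) (f N))
             / Lnorm (gauss_infty Q B) p%:E (EFin \o f N)) @ \oo --> +oo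
    & ~ (exists C : R,
        forall (f : 'cV[R]_n -> R) (N : nat) (t : nat -> R),
          f \in Lfun (gauss_infty Q B) 1 ->
          (1 <= N)%N -> strict_incr N t \/ strict_decr N t ->
          seq_in [set s : R | (0 < s)%R] N t ->
          weak_norm (gauss_infty Q B) (OU_oscillation Q B rho N t f)
            <= C%:E * Lnorm (gauss_infty Q B) 1 (EFin \o f))].
Proof.
case: n => [//|m] in Q B n_gt0 Q_posdef B_hurwitz *.
set mu := gauss_infty Q B.
have [f [t [upper fam]]] := oscillation_family Q_posdef B_hurwitz rho_bounds.
have p0 : (0 < p)%R by exact: lt_le_trans p_ge1.
pose a N : R := ((N%:R / 16) `^ rho^-1)%R.
have a_ge0 N : (0 <= a N)%R by exact: powR_ge0.
have lowerL N : (4 <= N)%N ->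
    ((1 / 8) `^ p^-1 * a N)%:E <= Lnorm mu p%:E (OU_oscillation Q B rho N
        (t N) (f N)).
  move=> N4; have [_ _ _ [E [mE E8 EO]]] := fam N N4.
  have aO := Lnorm_ge_cst mu p_ge1 (a_ge0 N) mE EO.
  apply: (le_trans _ aO).
  rewrite mulrC EFinM lee_wpmul2l ?lee_fin// -poweR_EFin.
  apply: le_poweR => //; first by rewrite invr_ge0 ltW.
have e8 : (0 < (1 / 8) `^ p^-1 :> R)%R by rewrite powR_gt0.
have seq_pos N : (4 <= N)%N -> seq_in [set s : R | (0 < s)%R] N (t N).
  by move=> N4; have [_ tin _ _] := fam N N4 => i iN; have /andP[] := tin i iN.
split.
- move=> [C HC]; have [K K0 HK] := upper p p_ge1.
  near \oo => N.
  have N4 : (4 <= N)%N by near: N; exact: nbhs_infty_ge.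
  have [td tin fp _] := fam N N4; have [fL _] := fp p p_ge1.
  have := HC (f N) N (t N) fL (leq_trans (isT :
      (1 <= 4)%N) N4) (or_intror td) (seq_pos N N4).
  apply/negP; rewrite -ltNge.
  apply: (lt_le_trans _ (lowerL N N4)).
  apply: (@le_lt_trans _ _ ((`|C| * K) * Num.sqrt N%:R)%:E).
    rewrite -mulrA EFinM; apply:
        (@le_trans _ _ (`|C|%:E * Lnorm mu p%:E (EFin \o f N))).
      by apply: lee_wpmul2r; [exact: Lnorm_ge0|rewrite lee_fin ler_norm].
    by apply: lee_wpmul2l; [rewrite lee_fin|exact: HK].
  (* The added 1 makes the contradiction strict; the absolute value covers a negative C. *)
  rewrite lte_fin (@lt_le_trans _ _ ((`|C| * K + 1) * Num.sqrt N%:R)%R)//.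
    by rewrite ltr_pM2r ?ltrDl// sqrtr_gt0 ltr0n (leq_trans _ N4).
  by near: N; exact: powR_sqrt_growth.
- exists 4%N, f, t; split=> [N N4|].
    have [td tin fp _] := fam N N4; have [fL f0] := fp p p_ge1.
    by split.
  apply/cvgeyPge => A; have [K K0 HK] := upper p p_ge1.
  near=> N.
  have N4 : (4 <= N)%N by near: N; exact: nbhs_infty_ge.
  have [td tin fp _] := fam N N4; have [fL f0] := fp p p_ge1.
  have := lowerL N N4; have := HK N N4; move: f0.
  set L := Lnorm mu p%:E (EFin \o f N);
      set O := Lnorm mu p%:E (OU_oscillation _ _ _ _ _ _).
  have : 0 <= L by exact: Lnorm_ge0.
  (* Infinite values are ruled out by the upper bound and by nonnegativity, so the quotient is one
     by a positive real. *)
  case: L => [L| |]//; rewrite lee_fin eqe => L0 Lneq LK OL.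
  have {L0 Lneq}L0 : (0 < L)%R by rewrite lt_neqAle eq_sym Lneq.
  rewrite inver (gt_eqF L0) lee_pdivlMr//.
  apply: (le_trans _ OL); rewrite -EFinM lee_fin.
  apply: (@le_trans _ _ (`|A| * K * Num.sqrt N%:R)%R).
    by rewrite -mulrA (le_trans (ler_wpM2r (ltW L0) (ler_norm A)))//
        ler_wpM2l//.
  by near: N; exact: powR_sqrt_growth.
- move=> [C HC]; have [K K0 HK] := upper 1%R (lexx _).
  near \oo => N.
  have N4 : (4 <= N)%N by near: N; exact: nbhs_infty_ge.
  have [td tin fp [E [mE E8 EO]]] := fam N N4; have [fL _] := fp 1%R (lexx _).
  have := HC (f N) N (t N) fL (leq_trans (isT :
      (1 <= 4)%N) N4) (or_intror td) (seq_pos N N4).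
  apply/negP; rewrite -ltNge.
  have aN0 : (0 < a N)%R by rewrite powR_gt0// divr_gt0//
      ltr0n (leq_trans _ N4).
  (* The weak norm uses strict superlevel sets, so the level is half of the lower bound. *)
  have b0 : (0 < a N / 2)%R by rewrite divr_gt0.
  have Eb x : E x -> (a N / 2)%:E < `|OU_oscillation Q B rho N (t N) (f N) x|.
    move=> Ex; apply: (lt_le_trans _ (lee_abs _));
        apply: (lt_le_trans _ (EO x Ex)).
    by rewrite lte_fin ltr_pdivrMr// mulr_natr mulr2n ltrDl.
  apply: (lt_le_trans _ (@weak_norm_ge _ _ Q B _ _ _ b0 mE Eb)).
  apply: (@le_lt_trans _ _ ((`|C| * K) * Num.sqrt N%:R)%:E).
    rewrite -mulrA EFinM; apply:
        (@le_trans _ _ (`|C|%:E * Lnorm mu 1 (EFin \o f N))).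
      by apply: lee_wpmul2r; [exact: Lnorm_ge0|rewrite lee_fin ler_norm].
    by apply: lee_wpmul2l; [rewrite lee_fin|exact: HK].
  apply: (@lt_le_trans _ _ ((a N / 2)%:E * (1 / 8)%:E)); last first.
    by apply: lee_wpmul2l; [rewrite lee_fin ltW|].
  rewrite -EFinM lte_fin (@lt_le_trans _ _
      ((`|C| * K + 1) * Num.sqrt N%:R)%R)//.
    by rewrite ltr_pM2r ?ltrDl// sqrtr_gt0 ltr0n (leq_trans _ N4).
  have -> : (a N / 2 * (1 / 8) = 1 / 16 * a N)%R by field.
  near: N; apply: powR_sqrt_growth => //.
Unshelve. all: end_near. Qed.
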